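(* For each $\gamma\in\mathrm{Lim}\cup\{1\}$ with $\gamma<\omega_1$: (a) $\mathfrak h\ge\mathfrak h_{\omega^\gamma}\ge\mathfrak h_{\omega^{\gamma+1}}\ge\dots\ge\mathfrak h_{\omega^{\gamma+r}}\ge\dots\ge\omega_1$, and hence there is $r_0\in\omega$ such that $\mathfrak h_{\omega^{\gamma+r}}=\mathfrak h_{\omega^{\gamma+r_0}}$ for each $r\ge r_0$; (b) $\mathfrak t\ge\mathfrak t_{\omega^\gamma}\ge\mathfrak t_{\omega^{\gamma+1}}\ge\dots\ge\mathfrak t_{\omega^{\gamma+r}}\ge\dots\ge\omega_1$, and hence there is $r_0\in\omega$ such that $\mathfrak t_{\omega^{\gamma+r}}=\mathfrak t_{\omega^{\gamma+r_0}}$ for each $r\ge r_0$.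
   Context: $\mathrm{Lim}$ is the class of limit ordinals. For $0<\delta<\omega_1$, $\mathcal I_{\omega^\delta}=\{I\subset\omega^\delta:\omega^\delta\text{ does not order-embed into }I\}$ (an ideal), and $\mathfrak h_{\omega^\delta}=\mathfrak h((P(\omega^\delta)/\mathcal I_{\omega^\delta})^+)$, $\mathfrak t_{\omega^\delta}=\mathfrak t((P(\omega^\delta)/\mathcal I_{\omega^\delta})^+)$, where $(P(X)/\mathcal J)^+$ is the poset of nonzero elements of the quotient Boolean algebra. For a poset $\mathbb P$, $\mathfrak h(\mathbb P)$ is its distributivity number (the least cardinal $\kappa$ such that some family of $\kappa$ open dense subsets of $\mathbb P$ has non-dense intersection) and $\mathfrak t(\mathbb P)$ is its tower number (the least length of a decreasing well-ordered sequence in $\mathbb P$ with no lower bound). $\mathfrak h=\mathfrak h((P(\omega)/\mathrm{Fin})^+)$ and $\mathfrak t=\mathfrak t((P(\omega)/\mathrm{Fin})^+)$ are the usual cardinal invariants. *)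

(* Defs.v *)
From HB Require Import structures.
From mathcomp Require Import all_boot finmap.
From mathcomp Require Import boolp classical_sets functions cardinality wochoice.

Set Implicit Arguments.
Unset Strict Implicit.
Unset Printing Implicit Defensive.

Local Open Scope classical_set_scope.
Local Open Scope card_scope.

(* An ordinal is represented by a well-ordered type; ordinals are compared by
   order embeddings ([ord_le]) and identified up to isomorphism ([ord_eq]).
   Cardinals are the initial ordinals. *)
Record ordinalType := OrdinalType {
  ord_sort :> choiceType;
  ord_rel : rel ord_sort;
  ord_relP : well_order ord_rel }.

Arguments ord_rel {o}.

Definition ord_srel (a : ordinalType) : rel a :=
  fun x y => (x != y) && ord_rel x y.
Arguments ord_srel {a}.

Definition order_embedding (a b : ordinalType) (f : a -> b) :=
  {mono f : x y / ord_rel x y >-> ord_rel x y}.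

Definition ord_le (a b : ordinalType) := exists f : a -> b, order_embedding f.

Definition ord_eq (a b : ordinalType) :=
  exists2 f : a -> b, order_embedding f & bijective f.

Section OrdinalTheory.
Variable a : ordinalType.
Implicit Types x y z : a.

Lemma ord_rel_total : total (@ord_rel a).
Proof.
have wc : wo_chain (@ord_rel a) predT by move=> A _; apply: ord_relP.
by move=> x y; apply: (wo_chainW wc).
Qed.

Lemma ord_rel_refl : reflexive (@ord_rel a).
Proof. by move=> x; have := ord_rel_total x x; rewrite orbb. Qed.

Lemma ord_rel_anti : antisymmetric (@ord_rel a).
Proof.
have wc : wo_chain (@ord_rel a) predT by move=> A _; apply: ord_relP.
by move=> x y; apply: (wo_chain_antisymmetric wc).
Qed.

Lemma ord_rel_trans : transitive (@ord_rel a).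
Proof.
move=> y x z xy yz.
have /ord_relP[t [[tA tm] _]] : nonempty [pred u | u \in [:: x; y; z]].
  by exists x; rewrite !inE eqxx.
have tx : ord_rel t x by apply: tm; rewrite !inE eqxx.
have ty : ord_rel t y by apply: tm; rewrite !inE eqxx orbT.
have tz : ord_rel t z by apply: tm; rewrite !inE eqxx !orbT.
move: tA; rewrite !inE => /or3P[] /eqP e; subst t => //.
  by have -> : x = y by apply: ord_rel_anti; rewrite xy tx.
by have <- : y = z by apply: ord_rel_anti; rewrite yz ty.
Qed.

Lemma ord_relN x y : ~~ ord_rel x y = ord_srel y x.
Proof.
rewrite /ord_srel; have := ord_rel_total x y.
case: eqVneq => [->|yx]; first by rewrite ord_rel_refl.
case xy : (ord_rel x y) => //=; case yx' : (ord_rel y x) => // _.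
by move: yx; rewrite (@ord_rel_anti x y) ?eqxx ?xy ?yx'.
Qed.

Lemma ord_srel_rel_trans y x z : ord_srel x y -> ord_rel y z -> ord_srel x z.
Proof.
move=> /andP[xy xy'] yz; rewrite /ord_srel (ord_rel_trans xy' yz) andbT.
apply/eqP => xz; subst z; case/eqP: xy; apply: ord_rel_anti.
by rewrite xy' yz.
Qed.

Lemma ord_srel_wf : well_founded (@ord_srel a).
Proof.
move=> x; apply: contrapT => nx.
have /ord_relP[t [[tA tm] _]] : nonempty [pred u : a | `[< ~ Acc ord_srel u >]].
  by exists x; apply/asboolP.
move: tA => /asboolP; apply; constructor=> y yt.
apply: contrapT => ny; have /tm : y \in [pred u : a | `[< ~ Acc ord_srel u >]].
  by apply/asboolP.
by rewrite -[ord_rel t y]negbK ord_relN yt.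
Qed.

Lemma ord_seq_max (s : seq a) : s != [::] ->
  exists2 m, m \in s & forall x, x \in s -> ord_rel x m.
Proof.
elim: s => // x s IH _; have [->|/IH[m ms mP]] := eqVneq s [::].
  by exists x; rewrite ?inE// => y; rewrite !inE => /eqP->; exact: ord_rel_refl.
have [xm|mx] := orP (ord_rel_total x m).
  by exists m; rewrite ?inE ?ms ?orbT// => y; rewrite inE => /orP[/eqP->|/mP].
exists x; rewrite ?mem_head// => y; rewrite inE => /orP[/eqP->|/mP ym].
  exact: ord_rel_refl.
exact: ord_rel_trans ym mx.
Qed.

End OrdinalTheory.

Lemma well_order_wf (T : choiceType) (R : rel T) : antisymmetric R -> total R ->
  well_founded (fun x y => (x != y) && R x y) -> well_order R.
Proof.
move=> Ra Rt Rwf; apply: antisymmetric_well_order => // A [x Ax].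
apply: contrapT => nmin.
elim/(well_founded_ind Rwf): x Ax => x IH Ax; apply: nmin.
exists x; split=> // y Ay; have /orP[//|yx] := Rt x y.
have [<-|ny] := eqVneq y x; first by have := Rt y y; rewrite orbb.
by case: (IH y) => //; rewrite ny.
Qed.

Definition ord_zero : ordinalType.
Proof.
by apply: (@OrdinalType void (fun _ _ => true)) => A [[]].
Defined.

Definition ord_one : ordinalType.
Proof.
apply: (@OrdinalType unit (fun _ _ => true)) => A [[] At].
by exists tt; split=> [|[]]//; split.
Defined.

Section Successor.
Variable a : ordinalType.

(* [None] is put above all the elements of [a]. *)
Definition succ_rel : rel (option a) := fun u v =>
  match u, v with
  | _, None => true
  | None, Some _ => false
  | Some x, Some y => ord_rel x y
  end.

Lemma succ_rel_wo : well_order succ_rel.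
Proof.
apply: antisymmetric_well_order.
  by move=> [x|] [y|] //= /ord_rel_anti->.
move=> A [u Au].
have [[x Ax]|nA] := pselect (exists x, Some x \in A).
  have /ord_relP[t [[tA tm] _]] : nonempty [pred x | Some x \in A] by exists x.
  by exists (Some t); split=> // -[y|] // Ay; apply: tm.
exists u; split=> // -[y|] Ay; first by case: nA; exists y.
by case: u {Au}.
Qed.

Definition ord_succ := OrdinalType succ_rel_wo.

End Successor.

Definition ord_addn (a : ordinalType) (r : nat) := iter r ord_succ a.

Definition ord_limit (a : ordinalType) :=
  nonempty (predT : {pred a}) /\ forall x : a, exists y, ord_srel x y.

(* omega ^ a: the finitely supported functions a -> nat, ordered by the value
   at the largest argument where they differ; [f] stands for the Cantor normal
   form given by the sum of the omega^x * f(x), [x] decreasing in the support. *)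
Section OmegaExp.
Variable a : ordinalType.

Definition cnf := {fsfun a -> nat with 0}.

Definition omega_exp_lt (f g : cnf) :=
  exists2 x : a, f x < g x & forall y, ord_srel x y -> f y = g y.

Definition omega_exp_rel : rel cnf := fun f g => (f == g) || `[< omega_exp_lt f g >].

Lemma omega_exp_lt_asym f g : omega_exp_lt f g -> omega_exp_lt g f -> False.
Proof.
move=> [x fgx fgP] [y gfy gfP].
have [xy|] := boolP (ord_rel x y); last first.
  by rewrite ord_relN => /gfP e; move: fgx; rewrite e ltnn.
have [xy'|nxy] := eqVneq x y.
  by subst y; have := ltn_trans fgx gfy; rewrite ltnn.
by have := fgP y; rewrite /ord_srel nxy xy => /(_ isT) e; move: gfy; rewrite e ltnn.
Qed.

Lemma omega_exp_rel_anti : antisymmetric omega_exp_rel.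
Proof.
move=> f g /andP[/orP[/eqP//|/asboolP fg] /orP[/eqP//|/asboolP gf]].
by case: (omega_exp_lt_asym fg gf).
Qed.

Lemma omega_exp_rel_total : total omega_exp_rel.
Proof.
move=> f g; have [->|fg] := eqVneq f g; first by rewrite /omega_exp_rel eqxx.
pose s := [seq x <- (finsupp f `|` finsupp g)%fset | f x != g x].
have sP x : (x \in s) = (f x != g x).
  rewrite mem_filter inE; case: (eqVneq (f x) (g x)) => //= nfg.
  apply: contraNT nfg; rewrite negb_or => /andP[xf xg].
  by rewrite !fsfun_dflt.
have s0 : s != [::].
  apply: contraNneq fg => s0; apply/eqP/fsfunP => x; apply/eqP.
  by have := sP x; rewrite s0 inE => /esym/negbT; rewrite negbK.
have [m ms mP] := ord_seq_max s0.
have eqm y : ord_srel m y -> f y = g y.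
  rewrite -ord_relN => nym; apply/eqP; apply: contraNT nym => fgy.
  by apply: mP; rewrite sP.
move: ms; rewrite sP neq_ltn => /orP[h|h]; apply/orP; [left|right];
  by apply/orP; right; apply/asboolP; exists m => // y /eqm.
Qed.

Lemma omega_exp_lt_wf : well_founded omega_exp_lt.
Proof.
(* [bel x f]: the support of [f] is below [x]. *)
pose bel (x : a) (f : cnf) := forall y, ord_srel x y -> f y = 0.
pose sbel (x : a) (f : cnf) := forall y, ord_rel x y -> f y = 0.
have lt0 (f g : cnf) : (forall y, g y = 0) -> ~ omega_exp_lt f g.
  by move=> g0 [x]; rewrite g0.
have dom (f g : cnf) x : omega_exp_lt f g -> bel x g -> bel x f.
  move=> [z fgz fgP] gx y xy; rewrite fgP ?gx//.
  rewrite -ord_relN; apply/negP => yz; move: fgz; rewrite gx//.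
  exact: ord_srel_rel_trans xy yz.
have emp (f : cnf) : Acc omega_exp_lt f \/ exists2 m, m \in finsupp f & bel m f.
  have [f0|/ord_seq_max[m ms mP]] := eqVneq (finsupp f : seq a) [::].
    left; constructor=> g /lt0[] y; rewrite fsfun_dflt//.
    by rewrite -[_ \in _]/(y \in (finsupp f : seq a)) f0.
  right; exists m => // y my; apply/eqP; rewrite -memNfinsupp.
  by apply/negP => /mP; apply/negP; rewrite ord_relN.
have sb (x : a) : (forall y, ord_srel y x -> forall f, bel y f -> Acc omega_exp_lt f) ->
    forall f, sbel x f -> Acc omega_exp_lt f.
  move=> IH f fx; have [//|[m ms mf]] := emp f.
  apply: (IH m) => //; rewrite -ord_relN; apply/negP => xm; move: ms.
  by rewrite mem_finsupp fx// eqxx.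
have key x : forall f, bel x f -> Acc omega_exp_lt f.
  elim/(well_founded_ind (@ord_srel_wf a)): x => x /sb accx f.
  have [n] := ubnP (f x); elim: n f => [f|n IHn f fn fx]; first by rewrite ltn0.
  pose rest (f : cnf) : cnf :=
    [fsfun y in finsupp f => if y == x then 0 else f y | 0].
  have restE (h : cnf) y : rest h y = if y == x then 0 else h y.
    rewrite fsfunE; case: ifPn => // ny.
    by rewrite fsfun_dflt//; case: ifP.
  have srest (h : cnf) : bel x h -> sbel x (rest h).
    move=> hx y xy; rewrite restE; case: eqVneq => // nyx.
    by apply: hx; rewrite /ord_srel eq_sym nyx.
  have := accx _ (srest _ fx).
  move: {-2}(rest f) (erefl (rest f)) => g eg accg.
  elim: accg f fn fx eg => {}g _ IHg f fn fx eg.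
  constructor=> f' f'f; have f'x := dom _ _ _ f'f fx.
  case: f'f => z f'fz f'fP.
  have xz : ord_rel z x.
    by rewrite -[ord_rel z x]negbK ord_relN; apply/negP => /fx e; rewrite e in f'fz.
  have [zx|nzx] := eqVneq z x.
    by subst z; apply: IHn => //; rewrite (leq_trans f'fz).
  have ex : f' x = f x by apply: f'fP; rewrite /ord_srel nzx.
  apply: (IHg (rest f')) => //; last by rewrite ex.
  rewrite eg; exists z; first by rewrite !restE (negbTE nzx).
  by move=> y /f'fP e; rewrite !restE e.
by move=> f; have [//|[m _ /key]] := emp f.
Qed.

Lemma omega_exp_wo : well_order omega_exp_rel.
Proof.
apply: well_order_wf; [exact: omega_exp_rel_anti|exact: omega_exp_rel_total|].
move=> f; elim: (omega_exp_lt_wf f) => {}f _ IH; constructor=> g.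
by move=> /andP[gf /orP[/eqP gf'|/asboolP/IH//]]; rewrite gf' eqxx in gf.
Qed.

Definition omega_exp := OrdinalType omega_exp_wo.

End OmegaExp.

Section OrdinalOrder.

Lemma order_embeddingP (a b : ordinalType) (f : a -> b) :
  {homo f : x y / ord_srel x y} -> order_embedding f.
Proof.
move=> fh x y; apply/idP/idP => [|xy].
  by apply: contraLR; rewrite !ord_relN => /fh.
have [->|nxy] := eqVneq x y; first exact: ord_rel_refl.
by have /fh/andP[] : ord_srel x y by rewrite /ord_srel nxy.
Qed.

Lemma order_embedding_srel (a b : ordinalType) (f : a -> b) :
  order_embedding f -> {mono f : x y / ord_srel x y}.
Proof. by move=> fe x y; rewrite -!ord_relN fe. Qed.

Lemma ord_le_trans b a c : ord_le a b -> ord_le b c -> ord_le a c.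
Proof. by move=> [f fe] [g ge]; exists (g \o f) => x y /=; rewrite ge fe. Qed.

Lemma ord_min (a : ordinalType) (S : set a) : (exists x, S x) ->
  exists2 x, S x & forall y, S y -> ord_rel x y.
Proof.
move=> [x Sx]; have /ord_relP[t [[tS tm] _]] : nonempty [pred x | `[< S x >]].
  by exists x; apply/asboolP.
by exists t; [apply/asboolP|move=> y Sy; apply: tm; apply/asboolP].
Qed.

Definition ord_segment (a b : ordinalType) :=
  exists x : b, exists2 f : a -> b, order_embedding f & forall y, ord_srel (f y) x.

Lemma ord_le_or_segment (a b : ordinalType) : ord_le a b \/ ord_segment b a.
Proof.
pose U x (F : forall z : a, ord_srel z x -> option b) :=
  [set y : b | forall z (zx : ord_srel z x), exists2 w, F z zx = Some w & ord_srel w y].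
pose step x F : option b :=
  if pselect (exists2 y, U x F y & forall y', U x F y' -> ord_rel y y') is left h
  then Some (s2val (cid2 h)) else None.
pose F := Fix (@ord_srel_wf a) (fun=> option b) step.
have FE x : F x = step x (fun z _ => F z).
  rewrite /F Fix_eq// => x' G H GH; congr step.
  by apply: functional_extensionality_dep => z; apply: functional_extensionality_dep.
have FS x y : F x = Some y -> U x (fun z _ => F z) y /\
    forall y', U x (fun z _ => F z) y' -> ord_rel y y'.
  by rewrite FE /step; case: pselect => // h [<-]; case: cid2.
have FN x : F x = None -> forall y, ~ U x (fun z _ => F z) y.
  rewrite FE /step; case: pselect => // h _ y Uy; apply: h.
  by apply: ord_min; exists y.
have Fh z x w y : ord_srel z x -> F z = Some w -> F x = Some y -> ord_srel w y.
  by move=> zx Fz /FS[/(_ z zx)[w']]; rewrite Fz => -[<-].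
have [[x0 x0N]|FT] := pselect (exists x, F x = None); last first.
  left; have {}FT x : {y | F x = Some y}.
    by case E : (F x) => [y|]; [exists y|case: FT; exists x].
  exists (fun x => projT1 (FT x)); apply: order_embeddingP => x y xy.
  by apply: (Fh x y) => //; [case: (FT x)|case: (FT y)].
right; have [x xN xm] := @ord_min a [set x | F x = None] (ex_intro _ x0 x0N).
have FT z : ord_srel z x -> exists y, F z = Some y.
  move=> zx; case E : (F z) => [y|]; first by exists y.
  by have := xm _ E; rewrite -[ord_rel _ _]negbK ord_relN zx.
have surj (y : b) : exists2 z, ord_srel z x & F z = Some y.
  have [z [zx [w Fz yw]] zm] : exists2 z, (ord_srel z x /\
        exists2 w, F z = Some w & ord_rel y w) &
      forall z', (ord_srel z' x /\ exists2 w, F z' = Some w & ord_rel y w) ->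
        ord_rel z z'.
    apply: ord_min; apply: contrapT => nz; apply: (FN _ xN y) => z zx.
    have [w Fz] := FT _ zx; exists w => //; rewrite -ord_relN; apply/negP => yw.
    by apply: nz; exists z; split=> //; exists w.
  exists z => //; rewrite Fz; congr Some; apply: ord_rel_anti; rewrite yw andbT.
  have [_] := FS _ _ Fz; apply=> z' z'z.
  have z'x : ord_srel z' x by apply: ord_srel_rel_trans z'z _; case/andP: zx.
  have [w' Fz'] := FT _ z'x; exists w' => //; rewrite -ord_relN; apply/negP => yw'.
  have /zm : ord_srel z' x /\ exists2 w, F z' = Some w & ord_rel y w.
    by split=> //; exists w'.
  by rewrite -[ord_rel _ _]negbK ord_relN z'z.
exists x, (fun y => s2val (cid2 (surj y))); last by move=> y; case: cid2.
apply: order_embeddingP => y y' yy'.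
case: (cid2 (surj y)) => z zx Fz; case: (cid2 (surj y')) => z' z'x Fz' /=.
rewrite -ord_relN; apply/negP => z'z; have [e|nz] := eqVneq z' z.
  by move: Fz'; rewrite e Fz => -[e']; move: yy'; rewrite e' /ord_srel eqxx.
have : ord_srel y' y by apply: Fh Fz' Fz; rewrite /ord_srel nz.
by rewrite -ord_relN; case/andP: yy' => _ ->.
Qed.

End OrdinalOrder.

Definition ord_lt (a b : ordinalType) := ord_le a b /\ ~ ord_le b a.

Definition is_least (Q : ordinalType -> Prop) (a : ordinalType) :=
  Q a /\ forall b, Q b -> ord_le a b.

Lemma exists_least (Q : ordinalType -> Prop) : (exists a, Q a) -> exists a, is_least Q a.
Proof.
move=> [a Qa].
have [[x0 x0S]|nS] := pselect (exists x : a, exists b, Q b /\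
    exists2 f : b -> a, order_embedding f & forall y, ord_srel (f y) x); last first.
  exists a; split=> // b Qb; have [//|[x fx]] := ord_le_or_segment a b.
  by case: nS; exists x, b.
have [x [b [Qb [f fe fx]]] xm] := @ord_min a [set x | exists b, Q b /\
    exists2 f : b -> a, order_embedding f & forall y, ord_srel (f y) x]
    (ex_intro _ x0 x0S).
exists b; split=> // c Qc; have [//|[y [g ge gy]]] := ord_le_or_segment b c.
have /xm : exists c, Q c /\
    exists2 h : c -> a, order_embedding h & forall z, ord_srel (h z) (f y).
  exists c; split=> //; exists (f \o g) => [u v|z] /=; first by rewrite fe ge.
  by rewrite order_embedding_srel.
by rewrite -[ord_rel _ _]negbK ord_relN fx.
Qed.

(* Unique up to isomorphism; [ord_zero] is a junk value for an empty class.
   Classes of ordinals are plain predicates, as [ordinalType] is too large for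
   [set]. *)
Definition least_ord (Q : ordinalType -> Prop) : ordinalType :=
  if pselect (exists a, is_least Q a) is left h then projT1 (cid h) else ord_zero.

Lemma least_ordP (Q : ordinalType -> Prop) : (exists a, Q a) -> is_least Q (least_ord Q).
Proof. by move=> /exists_least h; rewrite /least_ord; case: pselect => // h'; case: cid. Qed.

Definition omega1 : ordinalType := least_ord (fun a => ~ countable [set: a]).

Lemma omega1P : is_least (fun a => ~ countable [set: a]) omega1.
Proof.
apply: least_ordP; have [R Rwo] := well_ordering_principle (set nat).
exists (OrdinalType Rwo) => /pcard_injP[f finj].
pose D := [set n | exists2 A : set nat, f A = n & ~ A n].
have nD : ~ D (f D).
  by move=> [A fA AD]; apply: (AD); rewrite (finj A D) ?inE//; exists A.
by apply: (nD); exists D.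
Qed.

Definition cardinal_ord (a : ordinalType) :=
  forall b : ordinalType, [set: a] #= [set: b] -> ord_le a b.

Section PosetInvariants.
Variables (P : Type) (le : P -> P -> Prop).

Definition poset_open (D : set P) := forall p q, D p -> le q p -> D q.

Definition poset_dense (D : set P) := forall p, exists2 q, D q & le q p.

Definition distributivity_number : ordinalType :=
  least_ord (fun k => cardinal_ord k /\
    exists2 D : k -> set P, (forall i, poset_open (D i) /\ poset_dense (D i)) &
      ~ poset_dense (\bigcap_i D i)).

(* Sequences are only required to be weakly decreasing, which does not change
   the least length. *)
Definition tower_number : ordinalType :=
  least_ord (fun l =>
    exists2 p : l -> P, (forall i j, ord_srel i j -> le (p j) (p i)) &
      ~ exists q, forall i, le q (p i)).

End PosetInvariants.

(* (P(X)/J)^+ for an ideal J: the elements of P(X)/J are the classes of subsets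
   of X modulo a symmetric difference in J. *)
Section Quotient.
Variables (X : Type) (J : set (set X)).

Definition mod_class (A : set X) : set (set X) :=
  [set B | J (A `+` B)].

Definition nonzero_quotient :=
  {C : set (set X) | (exists A, C = mod_class A) /\ C <> mod_class set0}.

Definition quotient_le (C D : nonzero_quotient) :=
  exists A B, [/\ sval C = mod_class A, sval D = mod_class B & J (A `\` B)].

End Quotient.

Arguments quotient_le {X} J C D.

Definition Fin : set (set nat) := [set A | finite_set A].

Definition h_Fin := distributivity_number (quotient_le Fin).
Definition t_Fin := tower_number (quotient_le Fin).

Definition nonembed_ideal (a : ordinalType) : set (set a) :=
  [set I | ~ exists2 f : a -> a, order_embedding f & forall x, I (f x)].

Definition h_omega_exp (d : ordinalType) :=
  distributivity_number (quotient_le (@nonembed_ideal (omega_exp d))).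
Definition t_omega_exp (d : ordinalType) :=
  tower_number (quotient_le (@nonembed_ideal (omega_exp d))).

(* Main.v *)
Require Import Defs.
From mathcomp Require Import all_boot finmap.
From mathcomp Require Import boolp classical_sets functions cardinality wochoice.

(** For a countable [a > 0], [omega^a] is a sum over [n] of blocks of types
    [omega^(b n)] with [b n < a], and a set is positive for [I_(omega^a)] iff for
    all [k], infinitely many blocks meet it in a copy of [omega^(b k)].
    Consequently [I_(omega^a)] is an ideal (by induction on [a]), the poset is
    sigma-closed (diagonalize through the blocks), whence the lower bound
    [omega1], and taking unions of blocks embeds [P(omega)/Fin] completely in
    [P(omega^a)/I], whence the comparison with [h] and [t].
    For a successor, [P(omega^(b+1))/I] is the reduced power of [P(omega^b)/I]
    modulo [Fin]. A lower bound [Q] of a lifted tower [(T i)], or a member of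
    all lifted dense sets, comes with indices [m i] from which on the terms of
    [Q] work for [i]. If some [m] bounds cofinally many [m i], a single term of
    [Q] works for all [i]; otherwise the cofinality is countable, and
    sigma-closure applies. Finally, a nonincreasing sequence of ordinals is
    eventually constant. *)

Set Implicit Arguments.
Unset Strict Implicit.
Unset Printing Implicit Defensive.

Local Open Scope classical_set_scope.
Local Open Scope card_scope.

(** * Well-orders and embeddings *)

Lemma ord_srel_rel (a : ordinalType) (x y : a) : ord_srel x y -> ord_rel x y.
Proof. by case/andP. Qed.

Lemma ord_srelxx (a : ordinalType) (x : a) : ord_srel x x = false.
Proof. by rewrite /ord_srel eqxx. Qed.

Lemma ord_rel_srel_trans (a : ordinalType) (y x z : a) :
  ord_rel x y -> ord_srel y z -> ord_srel x z.
Proof.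
move=> xy /andP[yz yz']; rewrite /ord_srel (ord_rel_trans xy yz') andbT.
apply/eqP => xz; subst z; case/eqP: yz; apply: ord_rel_anti.
by rewrite xy yz'.
Qed.

Lemma ord_srel_trans (a : ordinalType) (y x z : a) :
  ord_srel x y -> ord_srel y z -> ord_srel x z.
Proof. by move=> xy /ord_srel_rel; apply: ord_srel_rel_trans. Qed.

Lemma ord_srel_tricho (a : ordinalType) (x y : a) :
  [\/ ord_srel x y, x = y | ord_srel y x].
Proof.
have [->|xy] := eqVneq x y; first by constructor 2.
have /orP[h|h] := ord_rel_total x y; first by constructor 1; rewrite /ord_srel xy.
by constructor 3; rewrite /ord_srel eq_sym xy.
Qed.

Lemma ord_le_refl a : ord_le a a.
Proof. by exists id. Qed.

(** If [f x] were below [x], then [f (f x)] would be below [f x], against the induction hypothesis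
    at [f x]. *)
Lemma order_embedding_ge (a : ordinalType) (f : a -> a) :
  order_embedding f -> forall x, ord_rel x (f x).
Proof.
move=> fe x; elim/(well_founded_ind (@ord_srel_wf a)): x => x IH.
rewrite -[ord_rel _ _]negbK ord_relN; apply/negP => fx.
have := IH _ fx; rewrite -[ord_rel _ _]negbK ord_relN order_embedding_srel//.
by rewrite fx.
Qed.

(** Composing the two embeddings gives a self-embedding of [b] that moves [x] strictly down. *)
Lemma ord_segmentN (a b : ordinalType) : ord_le b a -> ~ ord_segment a b.
Proof.
move=> [g ge] [x [f fe fx]].
have fge : order_embedding (f \o g) by move=> u v /=; rewrite fe ge.
by have := order_embedding_ge fge x; rewrite -[ord_rel _ _]negbK ord_relN fx.
Qed.

(* The pointwise minimum of all embeddings of [a] into [b] is an embedding onto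
   an initial segment of [b]; it is onto [b] because [b] embeds into [a]. *)
Lemma ord_le_anti (a b : ordinalType) : ord_le a b -> ord_le b a -> ord_eq a b.
Proof.
move=> [f0 f0e] ba.
have /choice[h hP] x : exists y, (exists2 f : a -> b, order_embedding f & f x = y) /\
    forall f : a -> b, order_embedding f -> ord_rel y (f x).
  have [|y Sy ym] := @ord_min b [set y | exists2 f : a -> b, order_embedding f & f x = y].
    by exists (f0 x), f0.
  by exists y; split=> // f fe; apply: ym; exists f.
have he : order_embedding h.
  apply: order_embeddingP => x x' xx'; have [[f fe <-] _] := hP x'.
  by apply: (@ord_rel_srel_trans _ (f x)); [exact: (hP x).2|rewrite order_embedding_srel].
exists h => //; have surj y : exists x, h x = y; last first.
  have [g gK] := choice surj; exists g => // x.
  by apply: ord_rel_anti; rewrite -!he !gK !ord_rel_refl.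
apply: contrapT => ny; have hy x : h x != y by apply/eqP => hx; apply: ny; exists x.
have [[x0 yx0]|nx] := pselect (exists x, ord_srel y (h x)); last first.
  apply: (ord_segmentN ba); exists y, h => // x; have := ord_srel_tricho (h x) y.
  by case=> // [/eqP|h1]; [rewrite (negbTE (hy x))|case: nx; exists x].
have [x yx xm] := @ord_min a [set x | ord_srel y (h x)] (ex_intro _ x0 yx0).
have below z : ord_srel z x -> ord_srel (h z) y.
  move=> zx; have := ord_srel_tricho (h z) y.
  case=> // [/eqP|h1]; first by rewrite (negbTE (hy z)).
  by have := xm _ h1; rewrite -[ord_rel _ _]negbK ord_relN zx.
(* [x] is least with [h x] above the missed point [y]; lowering its value to [y] still gives an
   embedding, against the minimality of [h x]. *)
pose f z := if z == x then y else h z.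
have fe : order_embedding f.
  apply: order_embeddingP => z z' zz'; rewrite /f.
  case: eqVneq => [ez|nz]; case: eqVneq => [ez'|nz'].
  - by move: zz'; rewrite ez ez' ord_srelxx.
  - by apply: ord_srel_trans yx _; rewrite order_embedding_srel// -ez.
  - by apply: below; rewrite -ez'.
  - by rewrite order_embedding_srel.
by have := (hP x).2 f fe; rewrite /f eqxx -[ord_rel _ _]negbK ord_relN yx.
Qed.

(** If [s y] is always above [y] and [u] enumerates [a], then [x] is strictly increasing and
    cofinal. With [s] the identity, [x] is a monotone sequence dominating [u]. *)
Lemma cofinal_sequence (a : ordinalType) (s : a -> a) (u : nat -> a) :
    (forall x, ord_rel x (s x)) ->
  exists x : nat -> a, (forall n, ord_rel (s (x n)) (x n.+1)) /\
    forall n, ord_rel (u n) (x n).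
Proof.
move=> sx; pose m (y z : a) := if ord_rel y z then z else y.
have m1 y z : ord_rel y (m y z) by rewrite /m; case: ifP => // _; exact: ord_rel_refl.
have m2 y z : ord_rel z (m y z).
  rewrite /m; case: ifP => [_|/negbT]; first exact: ord_rel_refl.
  by rewrite ord_relN => /ord_srel_rel.
pose x := fix x n := if n is k.+1 then m (s (x k)) (u k.+1) else u 0.
exists x; split=> [n|[|n]] /=; [exact: m1|exact: ord_rel_refl|exact: m2].
Qed.

Lemma nondecreasing_sequence (a : ordinalType) (x : nat -> a) :
  (forall n, ord_rel (x n) (x n.+1)) -> forall n m, n <= m -> ord_rel (x n) (x m).
Proof.
move=> xS n m; elim: m => [|m IH]; first by rewrite leqn0 => /eqP->; exact: ord_rel_refl.
rewrite leq_eqVlt => /orP[/eqP->|/IH nm]; first exact: ord_rel_refl.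
exact: ord_rel_trans nm (xS m).
Qed.

Lemma countable_enum (T : Type) (x0 : T) : countable [set: T] ->
  exists u : nat -> T, forall x, exists n, u n = x.
Proof.
move=> /countable_injP[f fi].
have /choice[u uP] n : exists x, (exists y, f y = n) -> f x = n.
  have [[y fy]|ny] := pselect (exists y, f y = n); first by exists y.
  by exists x0.
exists u => x; exists (f x); apply: fi; rewrite ?inE//.
by apply: uP; exists x.
Qed.

Lemma countable_ord_le (a b : ordinalType) : ord_le a b ->
  countable [set: b] -> countable [set: a].
Proof.
move=> [f fe] /countable_injP[g gi]; apply/countable_injP; exists (g \o f).
move=> x y _ _ /= gfxy; have fxy : f x = f y by apply: gi; rewrite ?inE.
by apply: ord_rel_anti; rewrite -!fe fxy !ord_rel_refl.
Qed.

(** * Suborders, embeddings into a set, and indecomposability *)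

Section Suborder.
Variables (a : ordinalType) (P : set a).

Definition suborder_rel : rel {x : a | `[< P x >]} := fun x y => ord_rel (val x) (val y).

Lemma suborder_rel_wo : well_order suborder_rel.
Proof.
apply: antisymmetric_well_order => [x y|A [x Ax]].
  by move=> /ord_rel_anti/val_inj.
have [|t [t' At' <-] tm] := @ord_min a [set y | exists2 y', y' \in A & val y' = y].
  by exists (val x), x.
by exists t'; split=> // y Ay; apply: tm; exists y.
Qed.

Definition suborder := OrdinalType suborder_rel_wo.

Definition suborder_val (x : suborder) : a := val x.

Lemma suborder_val_embedding : order_embedding suborder_val.
Proof. by []. Qed.

Lemma suborder_valP x : P (suborder_val x).
Proof. by apply/asboolP; case: x. Qed.

Lemma suborder_val_surj x : P x -> exists y, suborder_val y = x.
Proof. by move=> /asboolP Px; exists (exist _ x Px). Qed.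

End Suborder.
Arguments suborder_val {a P}.

Lemma order_embedding_inj (a b : ordinalType) (f : a -> b) :
  order_embedding f -> injective f.
Proof. by move=> fe x y fxy; apply: ord_rel_anti; rewrite -!fe fxy !ord_rel_refl. Qed.

(** For [V = W] this is positivity of [A] modulo [nonembed_ideal]; other [V] measure the trace of
    [A] on the blocks. *)
Definition embeds (V W : ordinalType) (A : set W) :=
  exists2 f : V -> W, order_embedding f & forall x, A (f x).

Lemma embeds_sub (V W : ordinalType) (A B : set W) :
  A `<=` B -> embeds V A -> embeds V B.
Proof. by move=> AB [f fe fA]; exists f => // x; apply: AB. Qed.

Lemma embeds_le (U V W : ordinalType) (A : set W) :
  ord_le U V -> embeds V A -> embeds U A.
Proof.
move=> [g ge] [f fe fA]; exists (f \o g) => [x y|x] /=; [by rewrite fe ge|exact: fA].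
Qed.

(** The partition form of additive indecomposability; it makes [nonembed_ideal V] closed under
    unions. *)
Definition indecomposable (V : ordinalType) :=
  forall A B : set V, A `|` B = setT -> embeds V A \/ embeds V B.

Lemma indecomposableU (V W : ordinalType) (A B : set W) : indecomposable V ->
  embeds V (A `|` B) -> embeds V A \/ embeds V B.
Proof.
move=> Vi [f fe fAB]; have [|[g ge gA]|[g ge gB]] := Vi (f @^-1` A) (f @^-1` B).
- by apply/seteqP; split=> // x _; exact: fAB.
- by left; exists (f \o g) => // x y /=; rewrite fe ge.
- by right; exists (f \o g) => // x y /=; rewrite fe ge.
Qed.

(** * Blocks of [omega^a] *)

(* A decomposition of [W] into consecutive blocks [[set w | beta w = n]]; when
   the exponent is a limit, block [n] is [V n] without an initial segment. *)
Record block_decomposition (W : ordinalType) (V : nat -> ordinalType)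
    (beta : W -> nat) : Prop := BlockDecomposition {
  block_mono : forall w w', ord_rel w w' -> beta w <= beta w';
  block_in : forall n, exists rho : W -> V n, forall w w',
    beta w = n -> beta w' = n -> ord_srel w w' -> ord_srel (rho w) (rho w');
  block_out : forall k n, k < n -> embeds (V k) [set w | beta w = n];
  block_le : forall k k', k <= k' -> ord_le (V k) (V k');
  block_point : forall k, inhabited (V k);
  block_tail : forall k v, embeds (V k) [set u : V k | ord_rel v u] }.

Section CantorNormalForms.
Variable a : ordinalType.
Implicit Types f g : cnf a.

Lemma cnf_finite f : finite_set [set y | f y != 0].
Proof.
rewrite (_ : [set y | f y != 0] = [set` finsupp f]); first exact: finite_fset.
by apply/seteqP; split=> y /=; rewrite mem_finsupp.
Qed.

Lemma cnf_of_fun (F : a -> nat) : finite_set [set y | F y != 0] ->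
  exists f : cnf a, forall y, f y = F y.
Proof.
move=> Ffin; exists [fsfun y in fset_set [set y | F y != 0] => F y | 0]%fset => y.
rewrite fsfunE in_fset_set//; case: ifPn => //; rewrite notin_setE /= => /negP.
by rewrite negbK => /eqP.
Qed.

Lemma omega_exp_srelP (f g : omega_exp a) :
  reflect (omega_exp_lt f g) (ord_srel f g).
Proof.
apply: (iffP idP) => [/andP[fg /orP[/eqP fg'|/asboolP//]]|fg].
  by rewrite fg' eqxx in fg.
rewrite /ord_srel; apply/andP; split; last by apply/orP; right; apply/asboolP.
by apply/eqP => e; move: fg; rewrite e => -[x]; rewrite ltnn.
Qed.

Lemma omega_exp_top (f : cnf a) :
  (forall y, f y = 0) \/ exists2 x, f x != 0 & forall y, ord_srel x y -> f y = 0.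
Proof.
have [f0|/ord_seq_max[x xf xP]] := eqVneq (finsupp f : seq a) [::].
  left=> y; rewrite fsfun_dflt//.
  by rewrite -[_ \in _]/(y \in (finsupp f : seq a)) f0.
right; exists x => [|y xy]; first by rewrite -mem_finsupp.
apply/eqP; rewrite -memNfinsupp.
by apply/negP => /xP; apply/negP; rewrite ord_relN.
Qed.

Lemma omega_exp_inhabited : inhabited (omega_exp a).
Proof.
have [|f _] := @cnf_of_fun (fun=> 0); last by exists; exact: f.
by rewrite (_ : [set _ | _] = set0) //; apply/seteqP; split=> y; rewrite /= ?eqxx.
Qed.

Lemma cnf_single (x : a) n : exists f : cnf a, f x = n /\ forall y, y != x -> f y = 0.
Proof.
have [|f fE] := @cnf_of_fun (fun y => if y == x then n else 0).
  apply: (@sub_finite_set _ _ [set x]) => // y /=.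
  by case: (eqVneq y x) => // _; rewrite eqxx.
by exists f; split=> [|y /negbTE yx]; rewrite fE ?eqxx ?yx.
Qed.

(* The copy is the image of the natural (pointwise) addition of [v]. *)
Lemma omega_exp_tail (v : omega_exp a) :
  embeds (omega_exp a) [set u : omega_exp a | ord_rel v u].
Proof.
have /choice[s sE] (f : cnf a) : exists g : cnf a, forall y, g y = v y + f y.
  apply: cnf_of_fun; apply: (@sub_finite_set _ _ ([set y | v y != 0] `|` [set y | f y != 0])).
    by move=> y /=; rewrite addn_eq0 negb_and => /orP.
  by rewrite finite_setU; split; exact: cnf_finite.
exists s.
  apply: order_embeddingP => f g /omega_exp_srelP[x fgx fgP].
  apply/omega_exp_srelP; exists x; first by rewrite !sE ltn_add2l.
  by move=> y /fgP; rewrite !sE => ->.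
move=> f; have [f0|[x fx xP]] := omega_exp_top f.
  have e : s f = v :> cnf a by apply/fsfunP => y; rewrite sE f0 addn0.
  by rewrite e; exact: (@ord_rel_refl (omega_exp a)).
apply: (@ord_srel_rel (omega_exp a)); apply/omega_exp_srelP; exists x.
  by rewrite sE -[X in X < _]addn0 ltn_add2l lt0n.
by move=> y /xP f0; rewrite sE f0 addn0.
Qed.

End CantorNormalForms.

(** * Restriction and extension of Cantor normal forms along an embedding of exponents *)

Section Substitution.
Variables (a b : ordinalType) (i : b -> a).
Hypothesis ie : order_embedding i.

Lemma cnf_comp : exists rho : cnf a -> cnf b, forall f z, rho f z = f (i z).
Proof.
have /choice[rho rhoP] (f : cnf a) : exists g : cnf b, forall z, g z = f (i z).
  apply: cnf_of_fun; apply: (finite_preimage (B := [set y | f y != 0]) (f := i)).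
    by move=> x y _ _ /(order_embedding_inj ie).
  exact: cnf_finite.
by exists rho.
Qed.

(** Freezing the coefficients off the range of [i] at those of [c] selects a block; the free
    coefficients then trace a copy of [omega_exp b] in it. *)
Lemma cnf_extend (c : cnf a) : exists sigma : cnf b -> cnf a, forall h,
  (forall z, sigma h (i z) = h z) /\
  (forall y, (forall z, i z <> y) -> sigma h y = c y).
Proof.
suff /choice[s sP] : forall h : cnf b, exists g : cnf a, (forall z, g (i z) = h z) /\
    (forall y, (forall z, i z <> y) -> g y = c y) by exists s.
move=> h.
have /choice[F FP] y : exists m, (forall z, i z = y -> m = h z) /\
    ((forall z, i z <> y) -> m = c y).
  have [[z zy]|nz] := pselect (exists z, i z = y); last first.
    by exists (c y); split=> // z zy; case: nz; exists z.
  exists (h z); split=> [z' z'y|/(_ z)//].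
  by congr (h _); apply: (order_embedding_inj ie); rewrite z'y.
have [|g gF] := @cnf_of_fun a F; last first.
  exists g; split=> [z|y yi]; rewrite gF; first exact: (FP (i z)).1.
  exact: (FP y).2.
apply: (@sub_finite_set _ _ ([set y | c y != 0] `|` i @` [set z | h z != 0])); last first.
  rewrite finite_setU; split; first exact: cnf_finite.
  by apply: finite_image; exact: cnf_finite.
move=> y /= Fy; have [[z zy]|nz] := pselect (exists z, i z = y); [right|left].
  by exists z => //; rewrite -((FP y).1 _ zy).
by rewrite -(FP y).2// => z zy; apply: nz; exists z.
Qed.

(** The largest exponent at which [f] and [g] differ lies in the range of [i], since they agree off
    it; so it survives the restriction. *)
Lemma omega_exp_comp_srel (rho : cnf a -> cnf b) (f g : omega_exp a) :
    (forall f z, rho f z = f (i z)) ->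
    (forall y, (forall z, i z <> y) -> f y = g y) ->
  ord_srel f g -> ord_srel (rho f : omega_exp b) (rho g).
Proof.
move=> rhoE fg /omega_exp_srelP[x fgx fgP]; apply/omega_exp_srelP.
have [[z zx]|nz] := pselect (exists z, i z = x); last first.
  by move: fgx; rewrite fg ?ltnn// => z zx; apply: nz; exists z.
exists z; first by rewrite !rhoE zx.
by move=> y zy; rewrite !rhoE fgP// -zx order_embedding_srel.
Qed.

Lemma omega_exp_extend_embedding (c : cnf a) (sigma : cnf b -> cnf a) :
    (forall h, (forall z, sigma h (i z) = h z) /\
      (forall y, (forall z, i z <> y) -> sigma h y = c y)) ->
  @order_embedding (omega_exp b) (omega_exp a) sigma.
Proof.
move=> sP; apply: order_embeddingP => f g /omega_exp_srelP[z fgz fgP].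
have [f1 f2] := sP f; have [g1 g2] := sP g.
apply/omega_exp_srelP; exists (i z); first by rewrite f1 g1.
move=> y zy; have [[z' z'y]|nz] := pselect (exists z, i z = y).
  by rewrite -z'y f1 g1; apply: fgP; rewrite -(order_embedding_srel ie) z'y.
by rewrite f2 ?g2// => z' z'y; apply: nz; exists z'.
Qed.

End Substitution.

Lemma omega_exp_le (a b : ordinalType) : ord_le b a -> ord_le (omega_exp b) (omega_exp a).
Proof.
move=> [i ie]; have [c] := omega_exp_inhabited a.
by have [s sP] := cnf_extend ie c; exists s; exact: omega_exp_extend_embedding sP.
Qed.

(** * Block decompositions for exponents with a maximum, then for exponents with a strictly
    increasing cofinal sequence *)

Section MaximalExponent.
Variables (a b : ordinalType) (i : b -> a) (m : a).
Hypotheses (ie : order_embedding i) (im : forall z, ord_srel (i z) m)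
  (ma : forall y, y = m \/ exists z, i z = y).

Lemma max_exponent_mono (f g : omega_exp a) : ord_rel f g -> f m <= g m.
Proof.
move=> fg; have [->//|nfg] := eqVneq f g.
have /omega_exp_srelP[x fgx fgP] : ord_srel f g by rewrite /ord_srel nfg.
have [<-|[z zx]] := ma x; first exact: ltnW.
by rewrite fgP// -zx.
Qed.

(** Blocks are the level sets of the coefficient at the top exponent [m]; fixing it leaves a free
    Cantor normal form over [b]. *)
Lemma max_exponent_blocks :
  block_decomposition (fun=> omega_exp b) (fun f : omega_exp a => f m).
Proof.
have im' z : i z <> m by move=> e; have := im z; rewrite e ord_srelxx.
split.
- exact: max_exponent_mono.
- move=> n; have [rho rhoE] := cnf_comp ie; exists rho => f g fm gm.
  apply: omega_exp_comp_srel ie _ _ _ rhoE _ => y yi; have [->|[z zy]] := ma y.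
    by rewrite fm gm.
  by case: (yi z).
- move=> _ n _; have [c [cm _]] := cnf_single m n.
  have [s sP] := cnf_extend ie c; exists s => [|h /=].
    exact: omega_exp_extend_embedding sP.
  by rewrite (sP h).2.
- by move=> *; exact: ord_le_refl.
- by move=> _; exact: omega_exp_inhabited.
- by move=> _; exact: omega_exp_tail.
Qed.

End MaximalExponent.

Section LimitExponent.
Variables (a : ordinalType) (x : nat -> a).
Hypotheses (x_lt : forall n, ord_srel (x n) (x n.+1))
  (x_cof : forall y, exists n, ord_rel y (x n)).

Let V n := @suborder a [set y | ord_srel y (x n)].

(** The block number of [f] is the least [n] such that all exponents of [f] are below [x n]. *)
Lemma limit_exponent_blocks : exists beta : omega_exp a -> nat,
  block_decomposition (fun n => omega_exp (V n)) beta.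
Proof.
have x_le n m : n <= m -> ord_rel (x n) (x m).
  by apply: nondecreasing_sequence => k; exact: ord_srel_rel.
pose supp (f : cnf a) n := forall y, ord_rel (x n) y -> f y = 0.
have suppS f n m : n <= m -> supp f n -> supp f m.
  by move=> nm fn y my; apply: fn; apply: ord_rel_trans (x_le _ _ nm) my.
have /choice[beta betaP] f : exists n, forall m, n <= m <-> supp f m.
  have supp_ex : exists n, `[< supp f n >].
    have [f0|[y fy yP]] := omega_exp_top f; first by exists 0; apply/asboolP => y _.
    have [n yn] := x_cof y; exists n.+1; apply/asboolP => z nz; apply: yP.
    by apply: ord_rel_srel_trans yn _; apply: ord_srel_rel_trans (x_lt n) nz.
  case: (ex_minnP supp_ex) => n /asboolP fn nmin; exists n => m.
  by split=> [nm|/asboolP/nmin//]; exact: suppS nm fn.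
exists beta; split.
- move=> f g fg; apply/betaP => y gy; have [<-|nfg] := eqVneq g f.
    by move/betaP: (leqnn (beta g)) => /(_ y gy).
  have g0 z : ord_rel y z -> g z = 0.
    by move=> yz; move/betaP: (leqnn (beta g)) => /(_ z (ord_rel_trans gy yz)).
  have /omega_exp_srelP[z fgz fgP] : ord_srel f g by rewrite /ord_srel eq_sym nfg.
  rewrite fgP ?g0 ?ord_rel_refl//; have := ord_srel_tricho z y.
  case=> // [zy|/ord_srel_rel yz]; last by move: fgz; rewrite g0.
  by move: fgz; rewrite zy g0 ?ord_rel_refl.
- move=> n; have se := @suborder_val_embedding a [set y | ord_srel y (x n)].
  have [rho rhoE] := cnf_comp se; exists rho => f g fn gn.
  apply: omega_exp_comp_srel se _ _ _ rhoE _ => y yi.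
  have ny : ord_rel (x n) y.
    rewrite -[ord_rel _ _]negbK ord_relN; apply/negP => yn.
    by have [z zy] := @suborder_val_surj a [set y | ord_srel y (x n)] y yn; case: (yi z).
  have/betaP -> // : beta f <= n by rewrite fn.
  by have/betaP -> : beta g <= n by rewrite gn.
- move=> k [//|n]; rewrite ltnS => kn.
  have se := @suborder_val_embedding a [set y | ord_srel y (x k)].
  have ik (z : V k) : suborder_val z <> x n.
    move=> zn; have := @suborder_valP a [set y | ord_srel y (x k)] z; rewrite zn /=.
    by rewrite -ord_relN x_le.
  (* Adding the term of exponent [x n] with coefficient 1 to the forms over [V k] puts them all in
     block [n.+1]: the exponents are below [x n.+1], but not all below [x n]. *)
  have [c [c1 c0]] := cnf_single (x n) 1; have [s sP] := cnf_extend se c.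
  exists s => [|h]; first exact: omega_exp_extend_embedding sP.
  have [s1 s2] := sP h; apply/eqP; rewrite eqn_leq; apply/andP; split.
    apply/betaP => y ny; rewrite s2 => [|z zy].
      by apply: c0; apply/eqP => yn; move: ny; rewrite yn; apply/negP; rewrite ord_relN.
    have := @suborder_valP a [set y | ord_srel y (x k)] z; rewrite zy /= -ord_relN.
    by rewrite (ord_rel_trans _ ny)// x_le// (leq_trans kn).
  rewrite ltnNge; apply/negP => /betaP/(_ (x n)).
  by rewrite s2// c1 ord_rel_refl => /(_ isT).
- move=> k k' kk'; apply: omega_exp_le.
  have H (z : V k) : exists z' : V k', suborder_val z' = suborder_val z.
    apply: suborder_val_surj => /=; apply: ord_srel_rel_trans (x_le _ _ kk').
    exact: (@suborder_valP a [set y | ord_srel y (x k)] z).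
  have [j jP] := choice H; exists j => z z'.
  by rewrite -(suborder_val_embedding (j z)) !jP.
- by move=> k; exact: omega_exp_inhabited.
- by move=> k; exact: omega_exp_tail.
Qed.

End LimitExponent.

(** * Positive sets and indecomposability *)

Lemma strictly_increasing_choice (P : nat -> nat -> Prop) :
    (forall k N, exists2 n, N <= n & P k n) ->
  exists s : nat -> nat, (forall k, P k (s k)) /\ {homo s : k l / k < l}.
Proof.
move=> HP; have /choice[g gP] (p : nat * nat) : exists n, p.2 <= n /\ P p.1 n.
  by have [n] := HP p.1 p.2; exists n.
pose s := fix s k := if k is l.+1 then g (k, (s l).+1) else g (0, 0).
exists s; split=> [[|k]|]; [exact: (gP (_, _)).2|exact: (gP (_, _)).2|].
apply: homo_ltn => [n m p|k]; first exact: ltn_trans.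
exact: (gP (_, _)).1.
Qed.

Section Blocks.
Variables (W : ordinalType) (V : nat -> ordinalType) (beta : W -> nat).
Hypothesis BD : block_decomposition V beta.

Lemma block_srel (w w' : W) : beta w < beta w' -> ord_srel w w'.
Proof.
by rewrite -ord_relN; apply: contraTN => /(block_mono BD); rewrite -leqNgt.
Qed.

(** The block criterion for positivity. A bounded copy of [V k] has a tail in one block, and copies
    of the [V k] in a strictly increasing sequence of blocks reassemble a copy of [W]. *)
Lemma embeds_blocks (A : set W) : embeds W A <->
  forall k N, exists2 n, N <= n & embeds (V k) (A `&` [set w | beta w = n]).
Proof.
split=> [[e ee eA] k N|Abig].
  (* A block beyond [k] and [N] holds a copy of [V k]; as embeddings do not lower points, its image
     under [e] stays in blocks numbered at least [N]. *)
  have [s se sn] := block_out BD (leq_maxl k.+1 N).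
  have [w0 w0b] : exists w, beta w = (maxn k.+1 N).+1.
    have [s' _ s'n] := block_out BD (leqW (leq_maxl k.+1 N)).
    by have [v] := block_point BD k; exists (s' v); exact: s'n.
  (* The block number of [e (s v)] is nondecreasing in [v] and bounded by that
     of [e w0], so it is constant on a tail of [V k]. *)
  have bnd v : beta (e (s v)) <= beta (e w0).
    apply: (block_mono BD); rewrite ee; apply: ord_srel_rel; apply: block_srel.
    by rewrite sn w0b.
  have [M [v0 Mv0] Mmax] : exists2 M, (exists v0, beta (e (s v0)) = M) &
      forall v, beta (e (s v)) <= M.
    have [v] := block_point BD k.
    have exM : exists n, `[< exists v, beta (e (s v)) = n >].
      by exists (beta (e (s v))); apply/asboolP; exists v.
    have ubM n : `[< exists v, beta (e (s v)) = n >] -> n <= beta (e w0).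
      by move=> /asboolP[u <-].
    case: (ex_maxnP exM ubM) => M /asboolP[v0 v0M] Mmax; exists M; first by exists v0.
    by move=> u; apply: Mmax; apply/asboolP; exists u.
  have [t te tv0] := block_tail BD v0.
  exists M.
    rewrite -Mv0; apply: (@leq_trans (beta (s v0))).
      by rewrite sn leq_maxr.
    by apply: (block_mono BD); exact: order_embedding_ge.
  exists (e \o s \o t) => [u v|v] /=; first by rewrite ee se te.
  split; first exact: eA.
  apply/eqP; rewrite eqn_leq Mmax -Mv0 (block_mono BD)// ee se; exact: tv0.
(* Conversely, block [k] of [W] is mapped through [V k] into the copy of [V k] found in block
   [n k]. *)
have [n [nP n_lt]] := strictly_increasing_choice (fun k N => Abig k N).
have /all_sig[e eP] k : {e : V k -> W |
    order_embedding e /\ forall v, A (e v) /\ beta (e v) = n k}.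
  by apply: cid; have [e ee eA] := nP k; exists e.
have /all_sig[r rP] k := cid (block_in BD k).
exists (fun w => e (beta w) (r (beta w) w)) => [|w]; last first.
  by have [_ /(_ (r (beta w) w))[]] := eP (beta w).
apply: order_embeddingP => w w' ww'.
have := block_mono BD (ord_srel_rel ww'); rewrite leq_eqVlt => /orP[/eqP bb'|bb'].
  by rewrite -bb' (order_embedding_srel (eP _).1); apply: rP.
by apply: block_srel; rewrite ((eP _).2 _).2 ((eP _).2 _).2 n_lt.
Qed.

(** If [A] and [B] both contain no copy of [W], then for large [l] and [n] neither contains a copy
    of [V l] within block [n]. For [n] above [l] that block holds a copy of [V l], which [A] and [B]
    cover, against indecomposability of [V l]. *)
Lemma block_indecomposable : (forall k, indecomposable (V k)) -> indecomposable W.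
Proof.
move=> Vi A B ABT; apply: contrapT => /not_orP[nA nB].
have small (C : set W) : ~ embeds W C -> exists k N, forall l n, k <= l -> N <= n ->
    ~ embeds (V l) (C `&` [set w | beta w = n]).
  move=> nC; apply: contrapT => H; apply: nC; apply/embeds_blocks => k N.
  apply: contrapT => kN; apply: H; exists k, N => l n kl Nn Cn; apply: kN; exists n => //.
  by apply: embeds_le Cn; exact: (block_le BD).
have [k [N kN]] := small _ nA; have [k' [N' kN']] := small _ nB.
pose l := maxn k k'; pose n := maxn l.+1 (maxn N N').
have Nn : N <= n /\ N' <= n by rewrite /n !leq_max !leqnn !orbT.
have := block_out BD (leq_maxl l.+1 (maxn N N')); rewrite -/n => Vl.
have [||h|h] := @indecomposableU (V l) W
  (A `&` [set w | beta w = n]) (B `&` [set w | beta w = n]).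
- exact: Vi.
- by apply: embeds_sub Vl; rewrite -setIUl ABT setTI.
- by apply: (kN l n) h; rewrite ?leq_maxl//; case: Nn.
- by apply: (kN' l n) h; rewrite ?leq_maxr//; case: Nn.
Qed.

End Blocks.

(** Either [a] has a maximum, or countability yields a strictly increasing cofinal sequence. The
    exponents of the blocks are strictly smaller than [a], which permits induction. *)
Lemma omega_exp_blocks (a : ordinalType) : countable [set: a] -> inhabited a ->
  exists (b : nat -> ordinalType) (beta : omega_exp a -> nat),
    (forall n, ord_le (b n) a /\ ~ ord_le a (b n)) /\
    block_decomposition (fun n => omega_exp (b n)) beta.
Proof.
move=> ca [x0].
have sub_le (x : a) : ord_le (@suborder a [set y | ord_srel y x]) a /\
    ~ ord_le a (@suborder a [set y | ord_srel y x]).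
  split; first by exists suborder_val.
  move=> /ord_segmentN; apply; exists x, suborder_val => // y.
  exact: (@suborder_valP a [set y | ord_srel y x]).
have [[m mP]|nm] := pselect (exists m : a, forall y, ord_rel y m).
  exists (fun=> @suborder a [set y | ord_srel y m]), (fun f : omega_exp a => f m).
  split=> [_|]; first exact: sub_le.
  apply: (max_exponent_blocks (@suborder_val_embedding a [set y | ord_srel y m])).
    exact: (@suborder_valP a [set y | ord_srel y m]).
  move=> y; have [->|ym] := eqVneq y m; [by left|right].
  by apply: suborder_val_surj; rewrite /= /ord_srel ym mP.
have /choice[s sP] (y : a) : exists z, ord_srel y z.
  by apply: contrapT => ny; apply: nm; exists y => z; rewrite -[ord_rel _ _]negbK ord_relN;
     apply/negP => yz; apply: ny; exists z.
have [u uP] := countable_enum x0 ca.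
have [x [xs xu]] := cofinal_sequence u (fun y => ord_srel_rel (sP y)).
have [||beta betaP] := @limit_exponent_blocks a x.
- by move=> n; apply: ord_srel_rel_trans (sP _) (xs n).
- by move=> y; have [n <-] := uP y; exists n.
by exists (fun n => @suborder a [set y | ord_srel y (x n)]), beta.
Qed.

(** In a least counterexample the blocks have smaller countable exponents, hence are indecomposable,
    and so is the whole. *)
Lemma omega_exp_indecomposable (a : ordinalType) : countable [set: a] ->
  indecomposable (omega_exp a).
Proof.
move=> ca; apply: contrapT => nia.
have [|b [[cb nib] bmin]] :=
    @exists_least (fun b => countable [set: b] /\ ~ indecomposable (omega_exp b)).
  by exists a.
have [ib|nb] := pselect (inhabited b).
  have [c [beta [cP BD]]] := omega_exp_blocks cb ib.
  apply: nib; apply: (block_indecomposable BD) => k; have [cb_le bc] := cP k.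
  apply: contrapT => nc; apply: bc; apply: bmin; split=> //.
  exact: countable_ord_le cb_le cb.
(* For exponent zero the power has a single point. *)
have e0 (f g : omega_exp b) : f = g :> cnf b.
  by apply/fsfunP => y; case: nb; exists; exact: y.
have id_in (C : set (omega_exp b)) f : C f -> embeds (omega_exp b) C.
  by move=> Cf; exists id => // g; rewrite (e0 g f).
apply: nib => A B AB; have [f] := omega_exp_inhabited b.
have : (A `|` B) f by rewrite AB.
by case=> /id_in; [left|right].
Qed.

Record set_ideal (X : Type) (J : set (set X)) : Prop := SetIdeal {
  ideal0 : J set0;
  ideal_sub : forall A B, A `<=` B -> J B -> J A;
  idealU : forall A B, J A -> J B -> J (A `|` B) }.

Lemma nonembed_set_ideal (W : ordinalType) : inhabited W -> indecomposable W ->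
  set_ideal (@nonembed_ideal W).
Proof.
move=> [w] Wi; split=> [[f _ /(_ w)]//|A B AB nB /(embeds_sub AB)//|A B nA nB].
by move=> /(indecomposableU Wi)[].
Qed.

Lemma Fin_ideal : set_ideal Fin.
Proof.
split=> [|A B /sub_finite_set//|A B]; first exact: finite_set0.
by rewrite /Fin /= finite_setU.
Qed.

(** * Invariants of a quotient in terms of positive sets *)

Section SetInvariants.
Variables (X : Type) (J : set (set X)).

(** This and the next definitions read the quotient poset on representatives: positive sets, ordered
    by inclusion modulo [J]. *)
Definition ideal_open (D : set (set X)) :=
  forall A B, D A -> ~ J B -> J (B `\` A) -> D B.

Definition ideal_dense (D : set (set X)) :=
  forall A, ~ J A -> exists B, [/\ ~ J B, J (B `\` A) & D B].

Definition nondistributive (k : ordinalType) :=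
  exists2 D : k -> set (set X), (forall i, ideal_open (D i) /\ ideal_dense (D i)) &
    ~ ideal_dense (\bigcap_i D i).

Definition has_tower (l : ordinalType) :=
  exists T : l -> set X, [/\ forall i, ~ J (T i),
    forall i j, ord_srel i j -> J (T j `\` T i) &
    ~ exists2 Q, ~ J Q & forall i, J (Q `\` T i)].

Hypothesis Ji : set_ideal J.

Lemma ideal_diff_trans B A C : J (A `\` B) -> J (B `\` C) -> J (A `\` C).
Proof.
move=> AB BC; apply: (ideal_sub Ji _ (idealU Ji AB BC)) => x [Ax nCx].
by have [Bx|nBx] := pselect (B x); [right|left].
Qed.

Lemma ideal_positiveI A B : ~ J A -> J (A `\` B) -> ~ J (A `&` B).
Proof.
move=> nA AB nAB; apply: nA; apply: (ideal_sub Ji _ (idealU Ji AB nAB)) => x Ax.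
by have [Bx|nBx] := pselect (B x); [right|left].
Qed.

Lemma mod_class_eqP A B :
  mod_class J A = mod_class J B <-> J (A `\` B) /\ J (B `\` A).
Proof.
split=> [e|[AB BA]].
  have : mod_class J A B.
    by rewrite e /mod_class /= setYK; exact: (ideal0 Ji).
  by rewrite /mod_class /= => h; split; apply: (ideal_sub Ji _ h) => x; [left|right].
have sub C D E : J (C `\` D) -> J (D `\` C) -> J (C `+` E) -> J (D `+` E).
  move=> CD DC CE.
  apply: (ideal_sub Ji _ (idealU Ji (idealU Ji CD DC) CE)) => x.
  have [Cx|nCx] := pselect (C x); have [Dx|nDx] := pselect (D x).
  - by move=> [[_ nE]|[_ []]//]; right; left.
  - by left; left.
  - by left; right.
  - by move=> [[]//|[Ex _]]; right; right.
by apply/seteqP; split=> E; apply: sub.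
Qed.

Lemma quotient_leE (C D : nonzero_quotient J) A B :
  sval C = mod_class J A -> sval D = mod_class J B ->
  quotient_le J C D <-> J (A `\` B).
Proof.
move=> CA DB; split=> [[A' [B' [CA' DB' AB']]]|AB]; last by exists A, B.
have /mod_class_eqP[AA' _] : mod_class J A = mod_class J A' by rewrite -CA.
have /mod_class_eqP[_ BB'] : mod_class J B = mod_class J B' by rewrite -DB.
exact: ideal_diff_trans AA' (ideal_diff_trans AB' BB').
Qed.

Lemma class_of_positive A : ~ J A -> exists C : nonzero_quotient J, sval C = mod_class J A.
Proof.
move=> nA; suff nz : mod_class J A <> mod_class J set0.
  by exists (exist _ (mod_class J A) (conj (ex_intro _ A erefl) nz)).
by move=> /mod_class_eqP[]; rewrite setD0.
Qed.

Lemma positive_of_class (C : nonzero_quotient J) :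
  exists A, sval C = mod_class J A /\ ~ J A.
Proof.
have [[A CA] nz] := svalP C; exists A; split=> // JA; apply: nz; rewrite CA.
apply/mod_class_eqP; rewrite setD0 set0D; split=> //; exact: (ideal0 Ji).
Qed.

(** A choice [R] of positive representatives carries families of open dense sets both ways; openness
    makes membership independent of the representative. *)
Lemma nondistributiveP (k : ordinalType) : nondistributive k <->
  exists2 D : k -> set (nonzero_quotient J),
    (forall i, poset_open (quotient_le J) (D i) /\ poset_dense (quotient_le J) (D i)) &
    ~ poset_dense (quotient_le J) (\bigcap_i D i).
Proof.
have /choice[R RP] := positive_of_class.
have leP C D : quotient_le J C D <-> J (R C `\` R D).
  by apply: quotient_leE; [case: (RP C)|case: (RP D)].
split=> [[D DP nD]|[D DP nD]].
  exists (fun i => [set C | D i (R C)]) => [i|nD'].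
    have [Do Dd] := DP i; split=> [C E CD /leP EC|C] /=.
      by apply: Do CD _ EC; case: (RP E).
    have [A [nA AC DA]] := Dd _ (RP C).2.
    have [E EA] := class_of_positive nA; exists E.
      apply: Do DA (RP E).2 _; have /mod_class_eqP[_ //] : mod_class J A = mod_class J (R E).
      by rewrite -EA (RP E).1.
    by apply/(quotient_leE EA (RP C).1).
  apply: nD => A nA; have [C CA] := class_of_positive nA.
  have [E DE EC] := nD' C; exists (R E); split; first by case: (RP E).
    by apply/(quotient_leE (RP E).1 CA).
  by move=> i _; exact: DE.
exists (fun i => [set A | exists2 C, D i C & sval C = mod_class J A]) => [i|nD'].
  have [Do Dd] := DP i; split=> [A B [C DC CA] nB BA|A nA].
    have [E EB] := class_of_positive nB; exists E => //; apply: Do DC _.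
    by apply/(quotient_leE EB CA).
  have [C CA] := class_of_positive nA; have [E DE EC] := Dd C.
  exists (R E); split; [by case: (RP E)|by apply/(quotient_leE (RP E).1 CA)|].
  by exists E => //; case: (RP E).
apply: nD => C; have [A [nA AC DA]] := nD' _ (RP C).2.
have [E EA] := class_of_positive nA; exists E; last by apply/(quotient_leE EA (RP C).1).
move=> i _; have [E' DE' E'A] := DA i I; have [Do _] := DP i; apply: Do DE' _.
by apply/(quotient_leE EA E'A); rewrite setDv; exact: (ideal0 Ji).
Qed.

Lemma has_towerP (l : ordinalType) : has_tower l <->
  exists2 p : l -> nonzero_quotient J,
    (forall i j, ord_srel i j -> quotient_le J (p j) (p i)) &
    ~ exists q, forall i, quotient_le J q (p i).
Proof.
split=> [[T [Tp Td Tn]]|[p pd pn]].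
  have /choice[p pT] i := class_of_positive (Tp i); exists p => [i j ij|[q qp]].
    by apply/(quotient_leE (pT j) (pT i)); exact: Td.
  apply: Tn; have [Q [qQ nQ]] := positive_of_class q; exists Q => // i.
  by apply/(quotient_leE qQ (pT i)).
have /choice[T TP] i := positive_of_class (p i); exists T; split=> [i|i j ij|[Q nQ QT]].
- by case: (TP i).
- by apply/(quotient_leE (TP j).1 (TP i).1); exact: pd.
apply: pn; have [q qQ] := class_of_positive nQ; exists q => i.
by apply/(quotient_leE qQ (TP i).1).
Qed.

Definition sigma_closed := forall I : nat -> set X, (forall n, ~ J (I n)) ->
  (forall n, J (I n.+1 `\` I n)) -> exists2 Q, ~ J Q & forall n, J (Q `\` I n).

Lemma ideal_open_bigcap (T : Type) (D : T -> set (set X)) :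
  (forall i, ideal_open (D i)) -> ideal_open (\bigcap_i D i).
Proof. by move=> Do A B DA nB BA i _; apply: Do (DA i I) nB BA. Qed.

Lemma ideal_dense_capI (D E : set (set X)) : ideal_open D -> ideal_dense D ->
  ideal_open E -> ideal_dense E -> ideal_dense (D `&` E).
Proof.
move=> Do Dd Eo Ed A nA; have [B [nB BA DB]] := Dd _ nA.
have [C [nC CB EC]] := Ed _ nB; exists C; split=> //.
  exact: ideal_diff_trans CB BA.
by split=> //; apply: Do DB nC CB.
Qed.

(** Starting from [A], one descends into the enumerated dense sets one at a time; by openness a
    lower bound of this sequence belongs to all of them. *)
Lemma sigma_closed_dense (T : Type) (D : T -> set (set X)) : sigma_closed ->
    countable [set: T] -> (forall i, ideal_open (D i) /\ ideal_dense (D i)) ->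
  ideal_dense (\bigcap_i D i).
Proof.
move=> sc cT DP A nA; have [[i0]|nT] := pselect (inhabited T); last first.
  exists A; split=> //; first by rewrite setDv; exact: (ideal0 Ji).
  by move=> i; case: nT.
have [u uP] := countable_enum i0 cT.
pose P := {B : set X | ~ J B}.
have /choice[g gP] (p : nat * P) : exists B : P,
    J (sval B `\` sval p.2) /\ D (u p.1) (sval B).
  have [B [nB BA DB]] := (DP (u p.1)).2 _ (svalP p.2).
  by exists (exist _ B nB).
pose B := fix B n : P := if n is m.+1 then g (m, B m) else exist _ A nA.
have [n|n|Q nQ QB] := sc (fun n => sval (B n)); first exact: (svalP (B n)).
  by have [] := gP (n, B n).
exists Q; split=> [//||i _]; first exact: QB 0.
have [n <-] := uP i; have [_ DB] := gP (n, B n); have [Do _] := DP (u n).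
exact: Do DB nQ (QB n.+1).
Qed.

(** The terms at [u n] need not come in decreasing order, so they are first dominated by a monotone
    sequence of indices. *)
Lemma sigma_closed_tower (l : ordinalType) (T : l -> set X) (u : nat -> l) : sigma_closed ->
    (forall i, ~ J (T i)) -> (forall i j, ord_srel i j -> J (T j `\` T i)) ->
  exists2 Q, ~ J Q & forall n, J (Q `\` T (u n)).
Proof.
move=> sc Tp Td; have Tle i j : ord_rel i j -> J (T j `\` T i).
  have [->|ij h] := eqVneq i j; first by rewrite setDv => _; exact: (ideal0 Ji).
  by apply: Td; rewrite /ord_srel ij.
have [x [xs xu]] := cofinal_sequence u (@ord_rel_refl l).
have [n|n|Q nQ QT] := sc (T \o x); [exact: Tp|exact/Tle/xs|].
by exists Q => // n; apply: ideal_diff_trans (QT n) (Tle _ _ (xu n)).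
Qed.

End SetInvariants.

(* [beta] induces a complete embedding [A |-> beta^-1 A] of [P(X)/J] into [P(Y)/K]. *)
Section CompleteEmbedding.
Variables (X Y : Type) (J : set (set X)) (K : set (set Y)) (beta : Y -> X).
Hypotheses (Ji : set_ideal J) (Ki : set_ideal K)
  (JK : forall A, J A <-> K (beta @^-1` A))
  (red : forall I, ~ K I -> exists2 A, ~ J A &
    forall B, B `<=` A -> ~ J B -> ~ K (I `&` beta @^-1` B)).

(** Here [A] is a reduction of [I] as provided by [red]. Were [A] minus [B] positive, [I] would meet
    its preimage in a positive set. *)
Let red_le I A B : (forall B, B `<=` A -> ~ J B -> ~ K (I `&` beta @^-1` B)) ->
  K (I `\` beta @^-1` B) -> J (A `\` B).
Proof.
move=> IA KB; apply: contrapT => nAB; apply: (IA _ _ nAB); first by move=> x [].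
by apply: (ideal_sub Ki _ KB) => y [Iy [_ nB]].
Qed.

Lemma complete_embedding_tower l : has_tower J l -> has_tower K l.
Proof.
move=> [T [Tp Td Tn]]; exists (fun i => beta @^-1` T i); split=> [i|i j ij|[Q nQ QT]].
- by move=> /JK; exact: Tp.
- by apply/(JK (T j `\` T i)); exact: Td.
have [A nA QA] := red nQ; apply: Tn; exists A => // i.
exact: red_le QA (QT i).
Qed.

Lemma complete_embedding_nondistributive k : nondistributive J k -> nondistributive K k.
Proof.
move=> [D DP nD]; exists (fun i => [set Q | exists2 A, D i A & K (Q `\` beta @^-1` A)]).
  move=> i; have [Do Dd] := DP i; split=> [Q R [A DA QA] nR RQ|Q nQ].
    by exists A => //; apply: ideal_diff_trans RQ QA.
  have [A nA QA] := red nQ; have [B [nB BA DB]] := Dd _ nA.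
  (* [B] is included in [A] only modulo [J], whereas the reduction property concerns genuine subsets
     of [A]; hence the intersection. *)
  exists (Q `&` beta @^-1` (B `&` A)); split.
  - by apply: QA; [move=> x []|exact: ideal_positiveI].
  - by apply: (ideal_sub Ki _ (ideal0 Ki)) => y [[]].
  - exists B => //; apply: (ideal_sub Ki _ (ideal0 Ki)) => y [[_ []]] By _.
    by case.
move=> dns; apply: nD => A nA.
have [|Q [nQ QA QD]] := dns (beta @^-1` A); first by move/JK.
have [B nB QB] := red nQ; exists B; split=> //; first exact: red_le QB QA.
move=> i _; have [C DC QC] := QD i I; have [Do _] := DP i.
by apply: Do DC nB _; exact: red_le QB QC.
Qed.

End CompleteEmbedding.

(* [P(Y)/K] is the reduced power of [P(X)/J]: a subset of [Y] is a sequence of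
   subsets of [X], and it is in [K] iff almost all its terms are in [J]. *)
Section ReducedPower.
Variables (X Y : Type) (J : set (set X)) (K : set (set Y)).
Variables (beta : Y -> nat) (rho : Y -> X) (c : nat -> X -> Y).
Let slice n (A : set Y) := [set x | A (c n x)].
Hypotheses (Ji : set_ideal J) (Jsc : sigma_closed J)
  (betac : forall n x, beta (c n x) = n) (rhoc : forall n x, rho (c n x) = x)
  (KJ : forall A, K A <-> exists N, forall n, N <= n -> J (slice n A)).

Let slice_rho n A : slice n (rho @^-1` A) = A.
Proof. by apply/seteqP; split=> x; rewrite /slice /= rhoc. Qed.

Lemma reduced_power_lift A : J A <-> K (rho @^-1` A).
Proof.
split=> [JA|/KJ[N /(_ N (leqnn _))]]; last by rewrite slice_rho.
by apply/KJ; exists 0 => n _; rewrite slice_rho.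
Qed.

Let positive_slice Q N : ~ K Q -> exists2 n, N <= n & ~ J (slice n Q).
Proof.
move=> nQ; apply: contrapT => H; apply: nQ; apply/KJ; exists N => n Nn.
by apply: contrapT => Jn; apply: H; exists n.
Qed.

(** If no [m] works, choose for each [m] an index [u m] from which on [r] exceeds [m]; then [i] lies
    below [u (r i)], so the [u m] are cofinal. *)
Let cofinal_or_countable (l : ordinalType) (r : l -> nat) :
  (exists m, forall i, exists2 j, ord_rel i j & r j <= m) \/
  exists u : nat -> l, forall i, exists n, ord_rel i (u n).
Proof.
have [h|h] := pselect (exists m, forall i, exists2 j, ord_rel i j & r j <= m); first by left.
right; have /choice[u uP] m : exists i, forall j, ord_rel i j -> m < r j.
  apply: contrapT => nm; apply: h; exists m => i; apply: contrapT => ni.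
  apply: nm; exists i => j ij; rewrite ltnNge; apply/negP => jm.
  by apply: ni; exists j.
exists u => i; exists (r i); apply: ord_srel_rel; rewrite -ord_relN.
by apply/negP => /uP; rewrite ltnn.
Qed.

Lemma reduced_power_tower l : has_tower J l -> has_tower K l.
Proof.
move=> [T [Tp Td Tn]]; exists (fun i => rho @^-1` T i); split=> [i|i j ij|[Q nQ QT]].
- by move=> /reduced_power_lift; exact: Tp.
- by apply/(reduced_power_lift (T j `\` T i)); exact: Td.
have Tle i j : ord_rel i j -> J (T j `\` T i).
  have [->|ij h] := eqVneq i j; first by rewrite setDv => _; exact: (ideal0 Ji).
  by apply: Td; rewrite /ord_srel ij.
have /choice[r rP] i : exists m, forall n, m <= n -> J (slice n Q `\` T i).
  have /KJ[m mP] := QT i; exists m => n /mP; apply: (ideal_sub Ji) => x.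
  by rewrite /slice /= rhoc.
apply: Tn; have [[m mP]|[u uP]] := cofinal_or_countable r.
  have [n mn nn] := positive_slice m nQ; exists (slice n Q) => // i.
  have [j ij jm] := mP i; apply: ideal_diff_trans (Tle _ _ ij) => //.
  by apply: rP; apply: leq_trans mn.
have [R nR RT] := sigma_closed_tower Ji u Jsc Tp Td; exists R => // i.
by have [n /Tle] := uP i; apply: ideal_diff_trans.
Qed.

(** The family is taken decreasing so that a slice lying in [D j] for cofinally many [j] lies in all
    of them. *)
Lemma reduced_power_nondistributive (k : ordinalType) (D : k -> set (set X)) :
    (forall i, ideal_open J (D i) /\ ideal_dense J (D i)) ->
    (forall i j, ord_rel i j -> D j `<=` D i) -> ~ ideal_dense J (\bigcap_i D i) ->
  nondistributive K k.
Proof.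
(* The lift of [D i] consists of the sets almost all of whose positive slices lie in [D i]. *)
move=> DP Dd nD; exists (fun i => [set Q | exists m, forall n, m <= n ->
    ~ J (slice n Q) -> D i (slice n Q)]) => [i|dns].
  have [Do Di] := DP i; split=> [A B [m mA] nB /KJ[m' m'BA]|A nA].
    exists (maxn m m') => n; rewrite geq_max => /andP[mn m'n] nBn.
    have BA := m'BA _ m'n; apply: (Do _ _ (mA _ mn _) nBn BA) => JA; apply: nBn.
    apply: (ideal_sub Ji _ (idealU Ji BA JA)) => x Bx.
    by have [Ax|nAx] := pselect (slice n A x); [right|left].
  have /choice[B BP] n : exists B, J (B `\` slice n A) /\
      (~ J (slice n A) -> ~ J B /\ D i B).
    have [JA|nJA] := pselect (J (slice n A)).
      by exists set0; split=> //; rewrite set0D; exact: (ideal0 Ji).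
    by have [B [nB BA DB]] := Di _ nJA; exists B.
  (* The slices of [Q] are [B n] where [slice n A] is positive, and empty elsewhere. *)
  pose Q := [set y | B (beta y) (rho y) /\ ~ J (slice (beta y) A)].
  have QE n : ~ J (slice n A) -> slice n Q = B n.
    by move=> nJ; apply/seteqP; split=> x; rewrite /slice /Q /= betac rhoc // => -[].
  have Q0 n : J (slice n A) -> slice n Q = set0.
    by move=> h; apply/seteqP; split=> x //; rewrite /slice /Q /= betac => -[_ []].
  exists Q; split.
  - move=> /KJ[N NP]; have [n Nn nn] := positive_slice N nA.
    by have := NP _ Nn; rewrite QE//; case: (BP n) => _ /(_ nn)[].
  - apply/KJ; exists 0 => n _; rewrite (_ : slice n _ = slice n Q `\` slice n A)//.
    have [h|h] := pselect (J (slice n A)); last by rewrite QE//; case: (BP n).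
    by rewrite Q0// set0D; exact: (ideal0 Ji).
  - exists 0 => n _; have [h|h] := pselect (J (slice n A)).
      by rewrite Q0// => /(_ (ideal0 Ji)).
    by rewrite QE//; case: (BP n) => _ /(_ h)[].
apply: nD => A nA.
have [|Q [nQ QA QD]] := dns (rho @^-1` A); first by move/reduced_power_lift.
have /choice[r rP] i := QD i I.
have [[m mP]|[u uP]] := cofinal_or_countable r.
  have /KJ[m' m'P] := QA; have [n] := positive_slice (maxn m m') nQ.
  rewrite geq_max => /andP[mn m'n] nn; exists (slice n Q); split=> //.
    by apply: (ideal_sub Ji _ (m'P _ m'n)) => x; rewrite /slice /= rhoc.
  move=> i _; have [j ij jm] := mP i; apply: (Dd _ _ ij).
  by apply: rP => //; apply: leq_trans mn.
have [||B [nB BA DB]] := @sigma_closed_dense _ J Ji nat (D \o u) Jsc _ _ A nA.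
- exact: countableP.
- by move=> n; exact: DP.
exists B; split=> // i _; have [n /Dd] := uP i; apply; exact: DB.
Qed.

End ReducedPower.

(** * The quotient by finite sets and the theorem *)

Lemma not_bounded (A : set nat) : ~ (exists N, forall n, A n -> n < N) ->
  forall N, exists2 n, N <= n & A n.
Proof.
move=> nb N; apply: contrapT => nN; apply: nb; exists N => n An.
by rewrite ltnNge; apply/negP => Nn; apply: nN; exists n.
Qed.

Lemma injective_infinite (s : nat -> nat) (A : set nat) : {homo s : k l / k < l} ->
  (forall n, A (s n)) -> ~ Fin A.
Proof.
move=> s_lt As Af; apply: infinite_nat.
rewrite (_ : [set: nat] = s @^-1` A); last by apply/seteqP; split=> // n _; exact: As.
apply: (finite_preimage (B := A) (f := s) _ Af) => k l _ _ skl; apply/eqP/contraT.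
by rewrite neq_ltn => /orP[] /s_lt; rewrite skl ltnn.
Qed.

Lemma FinP (A : set nat) : Fin A <-> exists N, forall n, A n -> n < N.
Proof.
split=> [Af|[N AN]]; last by apply: (sub_finite_set _ (finite_II N)) => n /AN.
apply: contrapT => /not_bounded AN.
have [|s [sA s_lt]] := @strictly_increasing_choice (fun _ n => A n).
  by move=> _; exact: AN.
exact: (injective_infinite s_lt sA).
Qed.

(** [B] consists of the even-indexed terms of a strictly increasing sequence in [A]; the odd-indexed
    ones remain outside it. *)
Lemma Fin_split (A : set nat) : ~ Fin A ->
  exists2 B, B `<=` A & ~ Fin B /\ ~ Fin (A `\` B).
Proof.
move=> /FinP/not_bounded AN.
have [|s [sA s_lt]] := @strictly_increasing_choice (fun _ n => A n).
  by move=> _; exact: AN.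
have s_inj k l : s k = s l -> k = l.
  move=> skl; apply/eqP/contraT.
  by rewrite neq_ltn => /orP[] /s_lt; rewrite skl ltnn.
exists [set s n.*2 | n in setT]; first by move=> _ [n _ <-]; exact: sA.
split.
  apply: (@injective_infinite (fun n => s n.*2)) => [k l kl|n]; last by exists n.
  by apply: s_lt; rewrite ltn_double.
apply: (@injective_infinite (fun n => s n.*2.+1)) => [k l kl|n].
  by apply: s_lt; rewrite ltnS ltn_double.
by split=> [|[m _ /s_inj e]]; [exact: sA|have := congr1 odd e; rewrite /= !odd_double].
Qed.

(** * The ideal of a block decomposition: sigma-closure and the embedding of the quotient by finite
    sets *)

Section BlockIdeal.
Variables (W : ordinalType) (V : nat -> ordinalType) (beta : W -> nat).
Hypotheses (BD : block_decomposition V beta) (Ki : set_ideal (@nonembed_ideal W)).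

Let not_nonembed (A : set W) : ~ nonembed_ideal A -> embeds W A.
Proof. by move=> /contrapT. Qed.

Lemma block_bounded (A : set W) N : (forall w, A w -> beta w < N) -> nonembed_ideal A.
Proof.
move=> AN /(embeds_blocks BD A)/(_ 0 N)[n Nn [f _ fA]].
have [v] := block_point BD 0; have [/AN + fn] := fA v.
by rewrite fn ltnNge Nn.
Qed.

Lemma block_spread (A : set W) (n : nat -> nat) : {homo n : k l / k < l} ->
    (forall k, embeds (V k) (A `&` [set w | beta w = n k])) ->
  embeds W A.
Proof.
move=> n_lt nA; apply/(embeds_blocks BD) => k N; exists (n (maxn k N)).
  apply: leq_trans (leq_maxr k N) _; elim: (maxn k N) => // m IH.
  by apply: leq_ltn_trans IH _; exact: n_lt.
by apply: embeds_le (nA _); apply: (block_le BD); exact: leq_maxl.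
Qed.

(** Diagonalization: from block [n k] keep the trace of the finite intersection [L k], which
    contains a copy of [V k]. What lies outside [I i] sits in blocks [n k] with [k < i], hence is
    bounded. *)
Lemma block_sigma_closed : sigma_closed (@nonembed_ideal W).
Proof.
move=> I Ip Id; pose L n := \bigcap_(i in [set i | i <= n]) I i.
have LI n : nonembed_ideal (I n `\` L n).
  elim: n => [|n IH].
    by apply: (ideal_sub Ki _ (ideal0 Ki)) => w [Iw []] i /=; rewrite leqn0 => /eqP->.
  apply: (ideal_sub Ki _ (idealU Ki (Id n) IH)) => w [Iw nL].
  have [Inw|] := pselect (I n w); [right|by left]; split=> // Lw; apply: nL => i /=.
  by rewrite leq_eqVlt => /orP[/eqP->//|]; exact: Lw.
have [|n [nP n_lt]] := @strictly_increasing_choice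
    (fun k n => embeds (V k) (L k `&` [set w | beta w = n])).
  move=> k N; have /not_nonembed/(embeds_sub (@subIsetr _ _ _)) :=
    ideal_positiveI Ki (Ip k) (LI k).
  by move=> /(embeds_blocks BD)/(_ k N).
exists [set w | exists k, L k w /\ beta w = n k].
  apply; apply: (block_spread n_lt) => k; apply: embeds_sub (nP k) => w [Lw bw].
  by split=> //; exists k.
move=> i; apply: (@block_bounded _ (n i)) => w [[k [Lw ->]] nI].
by apply: n_lt; rewrite ltnNge; apply/negP => ik; apply: nI; exact: Lw.
Qed.

Lemma block_preimage A : Fin A <-> nonembed_ideal (beta @^-1` A).
Proof.
rewrite FinP; split=> [[N AN]|nA]; first by apply: (@block_bounded _ N) => w; exact: AN.
apply: contrapT => /not_bounded AN; apply: nA; apply/(embeds_blocks BD) => k N.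
have [n Nn An] := AN (maxn k.+1 N); exists n; first by rewrite (leq_trans _ Nn) ?leq_maxr.
apply: embeds_sub (block_out BD (leq_trans (leq_maxl _ _) Nn)) => w /= bw.
by split=> //=; rewrite bw.
Qed.

(** [A] collects the numbers [n k] of blocks where [I] contains a copy of [V k]. An infinite part of
    [A] retains such copies for arbitrarily large [k], hence copies of every [V k] in infinitely
    many blocks. *)
Lemma block_reduction (I : set W) : ~ nonembed_ideal I -> exists2 A, ~ Fin A &
  forall B, B `<=` A -> ~ Fin B -> ~ nonembed_ideal (I `&` beta @^-1` B).
Proof.
move=> /not_nonembed/(embeds_blocks BD)/strictly_increasing_choice[n [nP n_lt]].
exists (range n).
  move=> /FinP[N NP]; have : n N < N by apply: NP; exists N.
  rewrite ltnNge => /negP; apply.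
  by elim: N {NP} => // m IH; apply: leq_ltn_trans IH _; exact: n_lt.
move=> B Bn /FinP/not_bounded BN; apply; apply/(embeds_blocks BD) => k N.
(* As [m = n l] is at least [n k], the index [l] is at least [k], and the copy of [V l] contains one
   of [V k]. *)
have [m mk Bm] := BN (maxn (n k) N); have [l _ lm] := Bn _ Bm.
exists m; first by rewrite (leq_trans _ mk) ?leq_maxr.
have kl : k <= l.
  rewrite leqNgt; apply/negP => /n_lt; rewrite lm ltnNge (leq_trans _ mk)//.
  exact: leq_maxl.
apply: embeds_le (block_le BD kl) _; apply: embeds_sub (nP l) => w /= [Iw bw].
by rewrite -lm; split=> //; split=> //=; rewrite bw lm.
Qed.

End BlockIdeal.

(** * Cardinals, attainment of the invariants, and the lower bound [omega1] *)

Lemma card_eq_surj (T U : Type) : [set: T] #= [set: U] ->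
  exists f : T -> U, forall y, exists x, f x = y.
Proof.
move=> /card_eqP[f].
exists (fun x => set_val (f (exist _ x (mem_set (A := [set: T]) I)))) => y.
have [[x xT] _ xy] := @surj _ _ _ _ f (exist _ y (mem_set (A := [set: U]) I)) I.
by exists x; rewrite (Prop_irrelevance (mem_set _) xT) xy.
Qed.

Lemma exists_cardinal (a : ordinalType) : exists c : ordinalType,
  [/\ cardinal_ord c, ord_le c a & [set: c] #= [set: a]].
Proof.
have [|c [ca cmin]] := @exists_least (fun c => [set: c] #= [set: a]).
  by exists a; exact: card_eqxx.
exists c; split=> // [b cb|]; last by apply: cmin; exact: card_eqxx.
by apply: cmin; apply: card_eq_trans ca; rewrite card_eq_sym.
Qed.

Lemma nondistributive_surj (X : Type) (J : set (set X)) (a b : ordinalType) (f : a -> b) :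
  (forall y, exists x, f x = y) -> nondistributive J b -> nondistributive J a.
Proof.
move=> fs [D DP nD]; exists (D \o f) => [i|dns]; first exact: DP.
apply: nD => A /dns[B [nB BA DB]]; exists B; split=> // i _.
by have [x <-] := fs i; exact: DB.
Qed.

(** Each [D i] is replaced by the intersection of the [D j] for [j] up to [i]. This stays dense
    because a proper initial segment of [k] is too short to be nondistributive. *)
Lemma decreasing_nondistributive (X : Type) (J : set (set X)) (k : ordinalType) :
    set_ideal J -> nondistributive J k ->
    (forall c, cardinal_ord c -> nondistributive J c -> ord_le k c) ->
  exists D : k -> set (set X), [/\ forall i, ideal_open J (D i) /\ ideal_dense J (D i),
    forall i j, ord_rel i j -> D j `<=` D i & ~ ideal_dense J (\bigcap_i D i)].
Proof.
move=> Ji [D DP nD] kmin.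
exists (fun i => \bigcap_(j in [set j | ord_rel j i]) D j); split.
- move=> i; split=> [A B DA nB BA j ji|].
    by have [Do _] := DP j; exact: Do (DA j ji) nB BA.
  pose b := @suborder k [set j | ord_srel j i].
  have bd : ideal_dense J (\bigcap_(j : b) D (suborder_val j)).
    (* Otherwise the cardinal [c] of the segment [b] would be nondistributive, so [k] would embed
       into [c] and hence into its own proper segment [b]. *)
    apply: contrapT => nb; have [c [cc cb /card_eq_surj[f fs]]] := exists_cardinal b.
    suff kb : ord_le k b.
      apply: ord_segmentN kb _; exists i, suborder_val => // y.
      exact: (@suborder_valP k [set j | ord_srel j i]).
    apply: ord_le_trans cb; apply: kmin => //; apply: nondistributive_surj fs _.
    by exists (fun j : b => D (suborder_val j)) => // j; exact: DP.
  have [Do Di] := DP i; move=> A nA.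
  have bo : ideal_open J (\bigcap_(j : b) D (suborder_val j)).
    by apply: ideal_open_bigcap => j; case: (DP (suborder_val j)).
  have [B [nB BA [DiB DB]]] := ideal_dense_capI Ji Do Di bo bd nA.
  exists B; split=> // j /= ji; have [->//|nji] := eqVneq j i.
  have [|z <-] := @suborder_val_surj k [set j | ord_srel j i] j.
    by rewrite /= /ord_srel nji.
  exact: DB.
- by move=> i j ij A DA l /= li; apply: DA; exact: ord_rel_trans li ij.
- move=> dns; apply: nD => A /dns[B [nB BA DB]]; exists B; split=> // i _.
  by apply: (DB i I); exact: ord_rel_refl.
Qed.

(** The assumed witness excludes the junk value of [least_ord]. *)
Lemma distributivity_numberP (X : Type) (J : set (set X)) : set_ideal J ->
    (exists k, cardinal_ord k /\ nondistributive J k) ->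
  let h := distributivity_number (quotient_le J) in
  [/\ cardinal_ord h, nondistributive J h &
    forall c, cardinal_ord c -> nondistributive J c -> ord_le h c].
Proof.
move=> Ji [k [kc /(nondistributiveP Ji) kn]].
rewrite /distributivity_number; set Q := (X in least_ord X).
have [[hc hn] hmin] : is_least Q (least_ord Q) by apply: least_ordP; exists k.
split=> //; first exact/(nondistributiveP Ji).
by move=> c cc /(nondistributiveP Ji) cn; apply: hmin.
Qed.

Lemma tower_numberP (X : Type) (J : set (set X)) : set_ideal J ->
    (exists l, has_tower J l) ->
  let t := tower_number (quotient_le J) in
  has_tower J t /\ forall l, has_tower J l -> ord_le t l.
Proof.
move=> Ji [l /(has_towerP Ji) lt].
rewrite /tower_number; set Q := (X in least_ord X).
have [tt tmin] : is_least Q (least_ord Q) by apply: least_ordP; exists l.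
split=> [|c /(has_towerP Ji) ct]; [exact/(has_towerP Ji)|exact: tmin].
Qed.

Lemma omega1_le_nondistributive (X : Type) (J : set (set X)) (k : ordinalType) :
  set_ideal J -> sigma_closed J -> nondistributive J k -> ord_le omega1 k.
Proof.
move=> Ji Jsc [D DP nD]; apply: omega1P.2 => ck; apply: nD.
exact: sigma_closed_dense.
Qed.

Lemma omega1_le_tower (X : Type) (J : set (set X)) (l : ordinalType) :
  set_ideal J -> sigma_closed J -> ~ J setT -> has_tower J l -> ord_le omega1 l.
Proof.
move=> Ji Jsc JT [T [Tp Td Tn]]; apply: omega1P.2 => cl; apply: Tn.
(* The empty sequence is bounded below by the whole space, which is positive. *)
have [[i0]|nl] := pselect (inhabited l); last first.
  by exists setT => // i; case: nl.
have [u uP] := countable_enum i0 cl.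
have [Q nQ QT] := sigma_closed_tower Ji u Jsc Tp Td.
by exists Q => // i; have [n <-] := uP i.
Qed.

(** The dense sets are indexed by all [A]: for infinite [A], the one at [A] contains the [B] that do
    not almost include [A]. An infinite [B] in all of them would fail at the index [B] itself. *)
Lemma Fin_nondistributive : exists k, cardinal_ord k /\ nondistributive Fin k.
Proof.
have [R Rwo] := well_ordering_principle (set nat).
have [k [kc _ /card_eq_surj[f fs]]] := exists_cardinal (OrdinalType Rwo).
exists k; split=> //; apply: nondistributive_surj fs _.
exists (fun A => [set B | Fin A \/ ~ Fin (A `\` B)]) => [A|].
  split=> [B C [|nB] nC CB|B nB]; [by left|right|].
    by move=> FAC; apply: nB; apply: (ideal_diff_trans Fin_ideal FAC CB).
  have [FA|nA] := pselect (Fin A).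
    by exists B; split=> //; [rewrite setDv; exact: (ideal0 Fin_ideal)|left].
  have [FAB|nAB] := pselect (Fin (A `\` B)); last first.
    by exists B; split=> //; [rewrite setDv; exact: (ideal0 Fin_ideal)|right].
  have [C CA [nC nAC]] := Fin_split nA; exists C; split=> //; last by right.
  by apply: (ideal_sub Fin_ideal _ FAB) => x [/CA].
move=> /(_ setT infinite_nat)[B [nB _ /(_ B I)[]//]]; rewrite setDv.
by apply; exact: (ideal0 Fin_ideal).
Qed.

(* Almost inclusion on infinite sets has no minimal element, so by Zorn's lemma
   some family well-ordered by it has no lower bound. *)
Lemma Fin_tower : exists l, has_tower Fin l.
Proof.
apply: contrapT => nt.
(* [R] is reversed almost inclusion: chains well-ordered by it are towers, and upper bounds are
   lower bounds. *)
pose R (A B : set nat) := `[< Fin (B `\` A) >].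
pose S : {pred set nat} := [pred A | `[< ~ Fin A >]].
have Fid := Fin_ideal.
have [|||M /asboolP nM Mmax] := @Zorn's_lemma (set nat) R S.
- by move=> A _; apply/asboolP; rewrite setDv; exact: (ideal0 Fid).
- move=> A B C _ _ _ /asboolP BA /asboolP CA; apply/asboolP.
  exact: ideal_diff_trans CA BA.
- move=> C CS Cwo; apply: contrapT => nub; apply: nt.
  pose RC : rel {A : set nat | A \in C} := fun A B => R (val A) (val B).
  have RCwo : well_order RC.
    move=> A [x Ax]; have [||t [[tA tm] tu]] :=
        Cwo [pred y | `[< exists2 z, z \in A & val z = y >]].
    - by move=> y /asboolP[z _ <-]; exact: valP.
    - by exists (val x); apply/asboolP; exists x.
    have /asboolP[t' t'A t't] := tA; exists t'; split.
      by split=> // y yA; rewrite /RC t't; apply: tm; apply/asboolP; exists y.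
    move=> y [yA ym]; apply: val_inj; rewrite t't; apply: tu; split.
      by apply/asboolP; exists y.
    by move=> z /asboolP[z' z'A <-]; exact: ym.
  exists (OrdinalType RCwo), (fun A => val A); split.
  - by move=> A; apply/asboolP; apply: (CS (val A)); exact: valP.
  - by move=> A B /andP[_ /asboolP].
  - move=> [Q nQ QC]; apply: nub; exists Q; first exact/asboolP.
    by move=> A CA; apply/asboolP; exact: (QC (exist _ A CA)).
have [B BM [nB nMB]] := Fin_split nM; apply: nMB.
have BS : B \in S by apply/asboolP.
have MB : R M B.
  by apply/asboolP; apply: (ideal_sub Fid _ (ideal0 Fid)) => x [/BM].
by have /asboolP := Mmax _ BS MB.
Qed.

(** * Successor exponents as reduced powers *)

Section SuccessorExponent.
Variable b : ordinalType.

Let beta (f : omega_exp (ord_succ b)) : nat := f None.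

Lemma Some_embedding : @order_embedding b (ord_succ b) Some.
Proof. by []. Qed.

Lemma succ_blocks : block_decomposition (fun=> omega_exp b) beta.
Proof.
apply: (max_exponent_blocks Some_embedding) => [z|[y|]]; [by []|right|by left].
by exists y.
Qed.

(** An element is the pair of its coefficient at the top exponent, [beta], and the remaining form,
    [rho]; [c n h] reassembles them. The criterion for [A] is [embeds_blocks] for constant [V],
    negated. *)
Lemma omega_exp_succ_reduced_power :
  exists (beta : omega_exp (ord_succ b) -> nat)
         (rho : omega_exp (ord_succ b) -> omega_exp b)
         (c : nat -> omega_exp b -> omega_exp (ord_succ b)),
  [/\ forall n h, beta (c n h) = n, forall n h, rho (c n h) = h &
    forall A : set (omega_exp (ord_succ b)), nonembed_ideal A <->
      exists N, forall n, N <= n -> nonembed_ideal [set h | A (c n h)]].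
Proof.
have [rho rhoE] := cnf_comp Some_embedding.
have /choice[c cP] n : exists s : cnf b -> cnf (ord_succ b), forall h,
    (forall z, s h (Some z) = h z) /\ s h None = n.
  have [e [en _]] := @cnf_single (ord_succ b) None n.
  have [s sP] := cnf_extend Some_embedding e; exists s => h.
  by have [s1 s2] := sP h; split=> //; rewrite s2.
have ce n : @order_embedding (omega_exp b) (omega_exp (ord_succ b)) (c n).
  have [e [en _]] := @cnf_single (ord_succ b) None n.
  apply: (omega_exp_extend_embedding Some_embedding (c := e)) => h.
  have [c1 c2] := cP n h; split=> // -[y /(_ y)//|_]; by rewrite c2.
have ck w : c (beta w) (rho w) = w :> cnf (ord_succ b).
  apply/fsfunP => -[y|]; have [c1 c2] := cP (beta w) (rho w); last by rewrite c2.
  by rewrite c1 rhoE.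
exists beta, rho, c; split=> [n h|n h|A].
- by case: (cP n h).
- by apply/fsfunP => z; rewrite rhoE; case: (cP n h).
have slice n : embeds (omega_exp b) (A `&` [set w | beta w = n]) <->
    embeds (omega_exp b) [set h : omega_exp b | A (c n h)].
  split=> [[e ee eA]|[e ee eA]].
    exists (rho \o e) => [|h /=]; last by have [Ae <-] := eA h; rewrite ck.
    apply: order_embeddingP => x y xy.
    apply: (omega_exp_comp_srel Some_embedding rhoE) => [[z /(_ z)//|_]|].
      have [_ ex] := eA x; have [_ ey] := eA y.
      by move: ex ey; rewrite /= /beta => -> ->.
    by rewrite order_embedding_srel.
  exists (c n \o e) => [x y|h]; first by rewrite -ee; exact: (ce n (e x) (e y)).
  by split; [exact: eA|case: (cP n (e h))].
split=> [nA|[N NA] /(embeds_blocks succ_blocks)/(_ 0 N)[n Nn /slice]]; last exact: NA.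
apply: contrapT => H; apply: nA; apply/(embeds_blocks succ_blocks) => _ N.
apply: contrapT => hN; apply: H; exists N => n Nn /slice An; apply: hN.
by exists n.
Qed.

End SuccessorExponent.

(** * The invariants for countable nonempty exponents, and their comparisons *)

Section CountableExponent.
Variable a : ordinalType.
Hypotheses (ca : countable [set: a]) (ia : inhabited a).

Lemma omega_exp_ideal : set_ideal (@nonembed_ideal (omega_exp a)).
Proof.
apply: nonembed_set_ideal (omega_exp_indecomposable ca).
exact: omega_exp_inhabited.
Qed.

Lemma omega_exp_sigma_closed : sigma_closed (@nonembed_ideal (omega_exp a)).
Proof.
have [b [beta [_ BD]]] := omega_exp_blocks ca ia.
exact: (block_sigma_closed BD omega_exp_ideal).
Qed.

Lemma nonembed_setT : ~ @nonembed_ideal (omega_exp a) setT.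
Proof. by apply; exists id. Qed.

Lemma Fin_nondistributive_omega_exp k :
  nondistributive Fin k -> nondistributive (@nonembed_ideal (omega_exp a)) k.
Proof.
have [b [beta [_ BD]]] := omega_exp_blocks ca ia.
apply: (complete_embedding_nondistributive Fin_ideal omega_exp_ideal (block_preimage BD)).
exact: (block_reduction BD).
Qed.

Lemma Fin_tower_omega_exp l :
  has_tower Fin l -> has_tower (@nonembed_ideal (omega_exp a)) l.
Proof.
have [b [beta [_ BD]]] := omega_exp_blocks ca ia.
apply: (complete_embedding_tower omega_exp_ideal (block_preimage BD)).
exact: (block_reduction BD).
Qed.

Lemma h_omega_expP : let h := h_omega_exp a in
  [/\ cardinal_ord h, nondistributive (@nonembed_ideal (omega_exp a)) h &
    forall c, cardinal_ord c -> nondistributive (@nonembed_ideal (omega_exp a)) c ->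
      ord_le h c].
Proof.
apply: (distributivity_numberP omega_exp_ideal).
have [k [kc kn]] := Fin_nondistributive; exists k; split=> //.
exact: Fin_nondistributive_omega_exp.
Qed.

Lemma t_omega_expP : let t := t_omega_exp a in
  has_tower (@nonembed_ideal (omega_exp a)) t /\
  forall l, has_tower (@nonembed_ideal (omega_exp a)) l -> ord_le t l.
Proof.
apply: (tower_numberP omega_exp_ideal).
by have [l lt] := Fin_tower; exists l; exact: Fin_tower_omega_exp.
Qed.

Lemma h_omega_exp_le_Fin : ord_le (h_omega_exp a) h_Fin.
Proof.
have [hc hn _] := distributivity_numberP Fin_ideal Fin_nondistributive.
have [_ _] := h_omega_expP; apply => //; exact: Fin_nondistributive_omega_exp.
Qed.

Lemma t_omega_exp_le_Fin : ord_le (t_omega_exp a) t_Fin.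
Proof.
have [tt _] := tower_numberP Fin_ideal Fin_tower.
by have [_] := t_omega_expP; apply; exact: Fin_tower_omega_exp.
Qed.

Lemma omega1_le_h_omega_exp : ord_le omega1 (h_omega_exp a).
Proof.
have [_ hn _] := h_omega_expP.
exact: (omega1_le_nondistributive omega_exp_ideal omega_exp_sigma_closed).
Qed.

Lemma omega1_le_t_omega_exp : ord_le omega1 (t_omega_exp a).
Proof.
have [tt _] := t_omega_expP.
exact: (omega1_le_tower omega_exp_ideal omega_exp_sigma_closed nonembed_setT).
Qed.

End CountableExponent.

Lemma countable_succ (a : ordinalType) :
  countable [set: a] -> countable [set: ord_succ a].
Proof.
move=> /countable_injP[f fi]; apply/countable_injP.
exists (fun x : ord_succ a => if x is Some y then (f y).+1 else 0).
by move=> [x|] [y|] //= _ _ [fxy]; congr Some; apply: fi; rewrite ?inE.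
Qed.

(** Minimality of [h_omega_exp a] allows a decreasing family of that length, which then lifts to the
    reduced power. *)
Lemma h_omega_exp_succ_le (a : ordinalType) : countable [set: a] -> inhabited a ->
  ord_le (h_omega_exp (ord_succ a)) (h_omega_exp a).
Proof.
move=> ca ia; have [hc hn hmin] := h_omega_expP ca ia.
have [D [DP Dd nD]] := decreasing_nondistributive (omega_exp_ideal ca) hn hmin.
have [beta [rho [c [bc rc KJ]]]] := omega_exp_succ_reduced_power a.
have [_ _] := h_omega_expP (countable_succ ca) (inhabits None); apply => //.
exact: (reduced_power_nondistributive (omega_exp_ideal ca)
  (omega_exp_sigma_closed ca ia) bc rc KJ DP Dd nD).
Qed.

Lemma t_omega_exp_succ_le (a : ordinalType) : countable [set: a] -> inhabited a ->
  ord_le (t_omega_exp (ord_succ a)) (t_omega_exp a).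
Proof.
move=> ca ia; have [tt _] := t_omega_expP ca ia.
have [beta [rho [c [bc rc KJ]]]] := omega_exp_succ_reduced_power a.
have [_] := t_omega_expP (countable_succ ca) (inhabits None); apply.
exact: (reduced_power_tower (omega_exp_ideal ca) (omega_exp_sigma_closed ca ia) rc KJ).
Qed.

(** A least value is attained at some [r0]; later terms embed into it by monotonicity and it embeds
    into them by minimality. *)
Lemma nonincreasing_stationary (o : nat -> ordinalType) :
  (forall r, ord_le (o r.+1) (o r)) ->
  exists r0, forall r, r0 <= r -> ord_eq (o r) (o r0).
Proof.
move=> o_dec; have [|_ [[r0 ->] o_min]] := @exists_least (fun a => exists r, a = o r).
  by exists (o 0), 0.
exists r0 => r r0r; apply: ord_le_anti; last by apply: o_min; exists r.
elim: r r0r => [|r IH]; first by rewrite leqn0 => /eqP->; exact: ord_le_refl.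
rewrite leq_eqVlt => /orP[/eqP->|/IH]; first exact: ord_le_refl.
exact: ord_le_trans (o_dec r).
Qed.

Theorem theorem6p1 (g : ordinalType)
  (g_lt_omega1 : ord_lt g omega1) (g_lim1 : ord_limit g \/ ord_eq g ord_one) :
  [/\ ord_le (h_omega_exp g) h_Fin,
      forall r : nat,
        ord_le (h_omega_exp (ord_addn g r.+1)) (h_omega_exp (ord_addn g r)),
      forall r : nat, ord_le omega1 (h_omega_exp (ord_addn g r)) &
      exists r0 : nat, forall r : nat, r0 <= r ->
        ord_eq (h_omega_exp (ord_addn g r)) (h_omega_exp (ord_addn g r0))] /\
  [/\ ord_le (t_omega_exp g) t_Fin,
      forall r : nat,
        ord_le (t_omega_exp (ord_addn g r.+1)) (t_omega_exp (ord_addn g r)),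
      forall r : nat, ord_le omega1 (t_omega_exp (ord_addn g r)) &
      exists r0 : nat, forall r : nat, r0 <= r ->
        ord_eq (t_omega_exp (ord_addn g r)) (t_omega_exp (ord_addn g r0))].
Proof.
have cg : countable [set: g].
  by apply: contrapT => ng; case: g_lt_omega1 => _; apply; exact: omega1P.2.
have ig : inhabited g.
  by case: g_lim1 => [[[x _] _]|[f _ [f' _ _]]]; [exists|exists; exact: f' tt].
have cgr r : countable [set: ord_addn g r].
  by elim: r => // r IH; exact: countable_succ.
have igr r : inhabited (ord_addn g r) by case: r => // r; exists; exact: None.
have h_dec r : ord_le (h_omega_exp (ord_addn g r.+1)) (h_omega_exp (ord_addn g r)).
  exact: h_omega_exp_succ_le.
have t_dec r : ord_le (t_omega_exp (ord_addn g r.+1)) (t_omega_exp (ord_addn g r)).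
  exact: t_omega_exp_succ_le.
split; split=> //.
- exact: h_omega_exp_le_Fin.
- by move=> r; exact: omega1_le_h_omega_exp.
- exact: (@nonincreasing_stationary (fun r => h_omega_exp (ord_addn g r))).
- exact: t_omega_exp_le_Fin.
- by move=> r; exact: omega1_le_t_omega_exp.
- exact: (@nonincreasing_stationary (fun r => t_omega_exp (ord_addn g r))).
Qed.
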